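(* Let $\{V(x)\}_{x\in\mathbb{G}}$ be i.i.d. real random variables. Fix $E\in\mathbb{R}$. Then the limit $$N(E)=\lim_{L\to\infty}\frac{1}{|\mathbb{G}_L|}\mathbb{E}\,\mathcal N(E;X^L)=\lim_{L\to\infty}\frac{1}{|\mathbb{G}_L|}\mathcal N(E;X^L)\quad\text{almost surely}$$ exists, is non-random, and is the same for every choice of $X^L\in\mathcal T_L:=\{H^{\mathbb{G}_L,\bullet},H^{\widetilde{\mathbb{G}}_L,\bullet}:\bullet\in\{S,N,D\}\}$ (this is the integrated density of states on the right half Sierpinski lattice $\bigcup_L\mathbb{G}_L$). Moreover, with $B_L=\{y\in\mathbb{G}:d(O,y)\le2^L\}=\mathbb{G}_L\cup\mathbb{G}_L'$, for any boundary condition $\bullet\in\{S,N,D\}$, $$N(E)=\lim_{L\to\infty}\frac{1}{|B_L|}\mathbb{E}\,\mathcal N(E;H^{B_L,\bullet})=\lim_{L\to\infty}\frac{1}{|B_L|}\mathcal N(E;H^{B_L,\bullet})\quad\text{almost surely}.$$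
   Context: Let $a_1=(0,0)$, $a_2=(1,0)$, $a_3=(1/2,\sqrt3/2)$, $T_0$ the unit equilateral triangle with these vertices, $T_{n+1}=T_n\cup(T_n+2^na_2)\cup(T_n+2^na_3)$. $\mathbb{G}_n$ is the set of vertices of unit triangles (translates of $T_0$) in $T_n$, with $x\sim y$ iff $x\ne y$ lie on a common unit triangle; $|\mathbb{G}_n|=(3^{n+1}+3)/2$. The Sierpinski lattice is $\mathbb{G}=\bigcup_n(\mathbb{G}_n\cup\mathbb{G}_n')$, $\mathbb{G}_n'$ the mirror image in the $y$-axis; $d$ is graph distance, $O=(0,0)$; $\deg(x)=4$ is the degree in $\mathbb{G}$ and $\deg_A(x)=\#\{y\in A:y\sim x\}$. The truncated triangle $\widetilde{\mathbb{G}}_L$ is $\mathbb{G}_L$ with its three corner (extreme) vertices removed. For finite $A\subseteq\mathbb{G}$, $f\in\ell^2(A)$: $-\Delta^{A,S}f(x)=\deg(x)f(x)-\sum_{y\in A,y\sim x}f(y)$; $-\Delta^{A,N}f(x)=\deg_A(x)f(x)-\sum_{y\in A,y\sim x}f(y)$; $-\Delta^{A,D}f(x)=(2\deg(x)-\deg_A(x))f(x)-\sum_{y\in A,y\sim x}f(y)$; and $H^{A,\bullet}=-\Delta^{A,\bullet}+V|_A$ on $\ell^2(A)$. $\mathcal N(E;X)$ is the number of eigenvalues (with multiplicity) of $X$ that are $\le E$. *)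

(* Defs.v *)
From HB Require Import structures.
From mathcomp Require Import all_boot all_order all_algebra.
From mathcomp Require Import all_classical all_reals all_analysis.
From mathcomp Require Import polyrcf.
Set Implicit Arguments. Unset Strict Implicit. Unset Printing Implicit Defensive.
Import Order.TTheory GRing.Theory Num.Theory.
Import numFieldNormedType.Exports.
Local Open Scope classical_set_scope.
Local Open Scope ring_scope.

(* Points of the triangular lattice: (i, j) stands for i*a2 + j*a3,
   with a2 = (1,0), a3 = (1/2, sqrt 3 / 2). *)
Definition pt := (int * int)%type.

Definition ptadd (p q : pt) : pt := (p.1 + q.1, p.2 + q.2).

(* Mirror image in the y-axis: i*a2 + j*a3 |-> (-i-j)*a2 + j*a3. *)
Definition mirror (p : pt) : pt := (- p.1 - p.2, p.2).

(* Lower-left corners of the unit (upward) triangles of T_n: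
   T_{n+1} = T_n u (T_n + 2^n a2) u (T_n + 2^n a3). *)
Fixpoint tri_corners (n : nat) : seq pt :=
  match n with
  | 0 => [:: (0, 0)]
  | m.+1 => let s := tri_corners m in
            s ++ map (ptadd ((2 ^ m)%N%:Z, 0)) s ++ map (ptadd (0, (2 ^ m)%N%:Z)) s
  end.

Definition tri_verts (p : pt) : seq pt := [:: p; ptadd p (1, 0); ptadd p (0, 1)].

Definition Gn (n : nat) : seq pt := undup (flatten (map tri_verts (tri_corners n))).

Definition Gn' (n : nat) : seq pt := map mirror (Gn n).

Definition inG (x : pt) : Prop := exists n, (x \in Gn n) \/ (x \in Gn' n).

Definition adj (x y : pt) : Prop :=
  x <> y /\ exists n, exists2 p, p \in tri_corners n &
    ((x \in tri_verts p) && (y \in tri_verts p)) \/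
    ((x \in map mirror (tri_verts p)) && (y \in map mirror (tri_verts p))).

Definition degA (A : seq pt) (x : pt) : nat := count (fun y => `[< adj y x >]) A.

Definition degG : nat := 4.

Inductive bc := bcS | bcN | bcD.

Definition diag_term (b : bc) (A : seq pt) (x : pt) : nat :=
  match b with
  | bcS => degG
  | bcN => degA A x
  | bcD => (2 * degG - degA A x)%N
  end.

(* Matrix of H^{A,b} = -Delta^{A,b} + V|_A on l^2(A), A a duplicate-free list,
   in the basis of indicator functions of the points of A (in list order). *)
Definition Hmx (R : realType) (b : bc) (A : seq pt) (v : pt -> R) : 'M[R]_(size A) :=
  \matrix_(i, j)
    let x := nth (0, 0) A i in let y := nth (0, 0) A j in
    (if i == j then (diag_term b A x)%:R + v x else 0)
    - (if `[< adj x y >] then 1 else 0).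

Definition eigcount (R : realType) (n : nat) (E : R) (X : 'M[R]_n) : nat :=
  (\sum_(r <- rootsR (char_poly X) | (r <= E)%R) mup r (char_poly X))%N.

Definition Gtilde (L : nat) : seq pt :=
  [seq x <- Gn L | x \notin [:: (0, 0); ((2 ^ L)%N%:Z, 0); (0, (2 ^ L)%N%:Z)]].

Definition BL (L : nat) : seq pt := undup (Gn L ++ Gn' L).

Definition iid (d : measure_display) (T : measurableType d) (R : realType)
  (P : probability T R) (I : set pt) (V : pt -> T -> R) : Prop :=
  [/\ (forall x, I x -> measurable_fun setT (V x)),
      (forall x y, I x -> I y -> forall B : set R, measurable B ->
          P (V x @^-1` B) = P (V y @^-1` B)) &
      (forall s : seq pt, uniq s -> (forall x, x \in s -> I x) ->
        forall B : pt -> set R, (forall x, measurable (B x)) ->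
          P (\bigcap_(x in [set` s]) (V x @^-1` B x)) =
          (\prod_(x <- s) P (V x @^-1` B x))%E)].

(* Main.v *)
(* Removing or adding k sites changes the number of eigenvalues <= E by at most
   k (Cauchy interlacing), so the three boundary conditions and the corner sites
   only matter up to a bounded error, and, with F_n the count on the truncated
   triangle with the simple boundary condition, F_{n+1} is the sum of three
   independent copies of F_n plus an error in [0, 3].  Hence E F_n / 3^n is
   nondecreasing and bounded, and Var F_{n+1} <= 6 Var F_n + 18, so that
   Var (F_n / 3^n) is summable and F_n / 3^n - E F_n / 3^n -> 0 almost surely.
   The limit is then normalised by |G_n| ~ (3/2) 3^n; the ball B_n consists, up
   to boundedly many sites, of a triangle and its mirror image, which are not
   joined by any edge. *)
Require Import Defs.
From HB Require Import structures.
From mathcomp Require Import all_boot all_order all_algebra.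
From mathcomp Require Import all_classical all_reals all_analysis.
From mathcomp Require Import polyrcf.
From mathcomp Require Import complex spectral measurable_realfun zify ring lra.
Import Order.TTheory GRing.Theory Num.Theory.
Import numFieldNormedType.Exports.
Local Open Scope classical_set_scope.
Local Open Scope ring_scope.

(** * Eigenvalue counts of symmetric matrices *)

(** Two obstacles shape the development. Eigenvalues are given only as roots of a characteristic
    polynomial, so every comparison of counts is drawn from one variational inequality,
    [spectral_count_le], proved over a closed field and brought back to real symmetric matrices by
    complexification. Moreover the count must be measurable in the potential: this follows from its
    monotonicity in the potential and its right continuity in the energy. The hypothesis [iid]
    speaks of rectangles only, so equality of laws and independence are extended to events by
    Dynkin's argument, and moments are then written through probabilities of superlevel sets.
    Corners are removed because the three translates then become disjoint and unlinked. The simple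
    boundary condition is preferred because its diagonal 4 does not see the region: restriction
    gives principal submatrices and translation only moves the potential. The crude variance factor
    6 is enough since it is below 9, the square of the growth factor 3. *)

Section MinMax.
Set Implicit Arguments.
Unset Strict Implicit.
Unset Printing Implicit Defensive.
Variable C : numClosedFieldType.
Local Open Scope sesquilinear_scope.

Definition qform n (X : 'M[C]_n) (v : 'rV[C]_n) : C := (v *m X *m v ^t*) 0 0.

(** Indices rather than values are selected, so that the cardinal counts eigenvalues with
    multiplicity. *)
Definition specpred n (X : 'M[C]_n) (E : C) : pred 'I_n :=
  fun i => spectral_diag X 0 i <= E.

Lemma specpredC n (X : 'M[C]_n) (E : C) :
  (#|specpred X E| + #|predC (specpred X E)| = n)%N.
Proof. by rewrite cardC card_ord. Qed.

(** [U] collects the rows of the unitary [spectralmx X] indexed by [S], and [c] lists the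
    coordinates of [v] in that eigenbasis. They vanish off [S], so both forms become sums over [S];
    the equivalence for [v = 0] lets trivial intersections be tested on coordinates. *)
Lemma spectral_subspace n (X : 'M[C]_n) (S : pred 'I_n) :
  X \is hermsymmx ->
  exists2 U : 'M[C]_(#|S|, n), \rank U = #|S| &
    forall v : 'rV[C]_n, (v <= U)%MS ->
      exists2 c : 'rV[C]_n, (v = 0 <-> forall i, S i -> c 0 i = 0) &
        qform X v = \sum_(i | S i) spectral_diag X 0 i * `|c 0 i| ^+ 2 /\
        qform 1%:M v = \sum_(i | S i) `|c 0 i| ^+ 2.
Proof.
move=> /hermitian_normalmx /orthomx_spectralP eqX.
set P := spectralmx X in eqX; set d := spectral_diag X in eqX *.
have Pu : P \is unitarymx by apply: spectral_unitarymx.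
have PP : P *m P ^t* = 1%:M by apply/unitarymxP.
have PP' : P ^t* *m P = 1%:M by apply: mulmx1C.
rewrite invmx_unitary // in eqX.
pose f := @enum_val _ S.
exists (rowsub f P).
  apply: mxrank_unitary; apply/row_unitarymxP => i j.
  rewrite !row_rowsub; move/row_unitarymxP: Pu => ->.
  by rewrite (inj_eq enum_val_inj).
move=> v /submxP[u ev].
have cS i : ~~ S i -> (v *m P ^t*) 0 i = 0.
  move=> nS; rewrite ev -mulmxA mul_rowsub_mx PP mxE big1 // => k _.
  rewrite !mxE /f; case: eqP => [e|]; last by rewrite mulr0.
  by have := enum_valP k; rewrite e unfold_in (negbTE nS).
exists (v *m P ^t*).
  split=> [-> i _|h]; first by rewrite mul0mx mxE.
  rewrite -[v]mulmx1 -PP' mulmxA.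
  suff -> : v *m P ^t* = 0 by rewrite mul0mx.
  apply/rowP => i; rewrite [RHS]mxE; case: (boolP (S i)) => [/h //|/cS //].
have cc : (v *m P ^t*) ^t* = P *m v ^t*.
  by rewrite trmx_mul map_mxM; congr (_ *m _); rewrite trmxCK.
have sumS (F : 'I_n -> C) : \sum_i F i * `|(v *m P ^t*) 0 i| ^+ 2
   = \sum_(i | S i) F i * `|(v *m P ^t*) 0 i| ^+ 2.
  rewrite (bigID S) /= [X in _ + X]big1 ?addr0 // => i /cS ->.
  by rewrite normr0 expr0n /= mulr0.
split.
  rewrite /qform {1}eqX -sumS.
  rewrite !mulmxA -(mulmxA _ P) -cc mul_mx_diag mxE; apply: eq_bigr => i _.
  by rewrite !mxE normCK mulrAC mulrC mulrA.
transitivity (\sum_(i | S i) 1 * `|(v *m P ^t*) 0 i| ^+ 2); last first.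
  by apply: eq_bigr => i _; rewrite mul1r.
rewrite -sumS /qform mulmx1.
have -> : v *m v ^t* = (v *m P ^t*) *m (P *m v ^t*).
  by rewrite mulmxA -(mulmxA v) PP' mulmx1.
by rewrite -cc mxE; apply: eq_bigr => i _; rewrite mul1r normCK !mxE.
Qed.

(* Variational comparison: [J] carries the part of the spectral subspace
   of [X] below [E] lying in [K] to a subspace meeting the spectral subspace
   of [Y] above [E'] trivially. *)
Lemma spectral_count_le n m k (X : 'M[C]_n) (Y : 'M[C]_m) (J : 'M[C]_(n, m))
    (K : 'M[C]_(k, n)) (E E' : C) :
  X \is hermsymmx -> Y \is hermsymmx -> E' \is Num.real ->
  (forall v : 'rV[C]_n, (v <= K)%MS -> v *m J = 0 -> v = 0) ->
  (forall v : 'rV[C]_n, (v <= K)%MS ->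
     qform Y (v *m J) - E' * qform 1%:M (v *m J)
       <= qform X v - E * qform 1%:M v) ->
  (#|specpred X E| + \rank K <= #|specpred Y E'| + n)%N.
Proof.
move=> hX hY Er Jinj le_q.
have [U rU qU] := spectral_subspace (specpred X E) hX.
have [W rW qW] := spectral_subspace (predC (specpred Y E')) hY.
have rJ : \rank ((U :&: K)%MS *m J) = \rank (U :&: K)%MS.
  apply/mxrank_injP/rowV0P => v.
  rewrite sub_capmx => /andP[]; rewrite sub_capmx => /andP[_ vK] /sub_kermxP.
  exact: Jinj.
(* For a common vector [w = v *m J], the form of [X - E] at [v] is nonpositive and that of [Y - E']
   at [w] is nonnegative. The comparison squeezes the latter to zero, and strictness above [E']
   kills every coordinate of [w]. *)
have cap0 : ((U :&: K)%MS *m J :&: W = 0)%MS.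
  apply/eqP/rowV0P => w; rewrite sub_capmx => /andP[/submxP[u ew] wW].
  have [vU vK] : (u *m (U :&: K)%MS <= U)%MS /\ (u *m (U :&: K)%MS <= K)%MS.
    by split; apply: (submx_trans (submxMl _ _)); rewrite ?capmxSl ?capmxSr.
  set v := u *m (U :&: K)%MS in vU vK.
  have {}ew : w = v *m J by rewrite ew mulmxA.
  have := le_q v vK; rewrite -ew.
  have [c _ [-> ->]] := qU v vU; have [e e0 [-> ->]] := qW w wW.
  rewrite !mulr_sumr -!sumrB.
  have le0 : \sum_(i | specpred X E i)
      (spectral_diag X 0 i * `|c 0 i| ^+ 2 - E * `|c 0 i| ^+ 2) <= 0.
    apply: sumr_le0 => i Si; rewrite -mulrBl mulr_le0_ge0 ?exprn_ge0 //.
    by rewrite subr_le0.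
  have dY i := mxOverP (hermitian_spectral_diag_real hY) 0 i.
  have ge0 i : predC (specpred Y E') i ->
      0 <= spectral_diag Y 0 i * `|e 0 i| ^+ 2 - E' * `|e 0 i| ^+ 2.
    move=> /= Si; rewrite -mulrBl mulr_ge0 ?exprn_ge0 //.
    rewrite subr_ge0 ltW // real_ltNge //; exact: dY.
  move=> /le_trans/(_ le0) h.
  have /eqP := le_anti (introT andP (conj h (sumr_ge0 _ ge0))).
  rewrite psumr_eq0 // => /allP a0; apply/e0 => i Si.
  have /implyP/(_ Si) := a0 i (mem_index_enum _).
  rewrite -mulrBl mulf_eq0 subr_eq0 expf_eq0 /= normr_eq0.
  case/orP => [/eqP eE|/eqP //].
  by move: Si; rewrite /= /specpred eE lexx.
(* Dimension count: cutting [U] by [K] loses at most [n - \rank K] dimensions, and the image under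
   [J] must fit beside [W] in dimension [m]. *)
have h1 := mxrank_sum_cap U K; have h2 := mxrank_sum_cap ((U :&: K)%MS *m J) W.
have b1 := rank_leq_col (U + K)%MS; have b2 := rank_leq_col ((U :&: K)%MS *m J + W)%MS.
rewrite cap0 mxrank0 rJ rW in h2; rewrite rU in h1.
have := specpredC Y E'.
move: h1 h2 b1 b2; rewrite addn0.
move: (\rank (U + K)) (\rank (U :&: K)) (\rank (_ + W)) (\rank K) => p q r s.
move: #|specpred X E| #|specpred Y E'| #|predC _| => x y z; lia.
Qed.

End MinMax.

(** * Real symmetric matrices: spectrum, interlacing, monotonicity and shifts *)

Section RealSymmetric.
Set Implicit Arguments.
Unset Strict Implicit.
Unset Printing Implicit Defensive.
Variable R : realType.
Implicit Types (E : R).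
Local Open Scope sesquilinear_scope.

Lemma eigcount_split n (X : 'M[R]_n) E (s : seq R) :
  char_poly X = \prod_(a <- s) ('X - a%:P) -> eigcount E X = count (<= E) s.
Proof.
move=> eX; rewrite /eigcount eX; set p := \prod_(a <- s) _.
have p0 : p != 0 by rewrite monic_neq0 // monic_prod_XsubC.
have memR x : (x \in rootsR p) = (x \in s).
  rewrite -(@root_prod_XsubC _ s) -/p.
  by have := roots_on_rootsR p0 x; rewrite in_itv /= => ->.
under eq_bigr do rewrite mu_prod_XsubC.
transitivity (\sum_(r <- undup s | (r <= E)%R) count_mem r s)%N.
  apply: perm_big; apply: uniq_perm; rewrite ?undup_uniq ?uniq_roots //.
  by move=> x; rewrite memR mem_undup.
rewrite -sum1_count -[RHS]big_undup_iterop_count; apply: eq_bigr => x _.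
by rewrite Monoid.iteropE iter_addn addn0 mul1n.
Qed.

Let toC n (X : 'M[R]_n) : 'M[R[i]]_n := map_mx (real_complex R) X.

Lemma toC_herm n (X : 'M[R]_n) : X^T = X -> toC X \is hermsymmx.
Proof.
move=> sX; apply: realsym_hermsym.
  apply/is_hermitianmxP; rewrite expr0 scale1r map_mx_id //.
  by rewrite /toC map_trmx sX.
by apply/mxOverP => i j; rewrite mxE complex_real.
Qed.

(** The spectral theorem is applied to the complexified matrix, whose diagonal form is real because
    it is Hermitian. Similarity gives the complex characteristic polynomial, and injectivity of the
    coefficient embedding brings the factorisation back to the reals. *)
Lemma symmetric_spectrum n (X : 'M[R]_n) : X^T = X ->
  {d : 'I_n -> R | char_poly X = \prod_i ('X - (d i)%:P) &
    forall i, spectral_diag (toC X) 0 i = (d i)%:C%C}.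
Proof.
move=> sX; pose d i := complex.Re (spectral_diag (toC X) 0 i).
have hX := toC_herm sX.
have dE i : spectral_diag (toC X) 0 i = (d i)%:C%C.
  have := mxOverP (hermitian_spectral_diag_real hX) 0 i.
  by move=> /RRe_real <-.
exists d => //.
apply: (@map_poly_inj _ _ (real_complex R)).
rewrite rmorph_prod map_char_poly -/(toC X).
under [RHS]eq_bigr do rewrite rmorphB /= map_polyX map_polyC /= -dE.
have /hermitian_normalmx /orthomx_spectralP eX := hX.
set P := spectralmx _ in eX; set D := diag_mx _ in eX.
have Pu : P \in unitmx by apply: spectral_unit.
transitivity (char_poly D).
  rewrite eX /char_poly /char_poly_mx.
  have -> : 'X%:M - map_mx polyC (invmx P *m D *m P)
     = map_mx polyC (invmx P) *m ('X%:M - map_mx polyC D) *m map_mx polyC P.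
    rewrite mulmxBr mulmxBl !map_mxM; congr (_ - _).
    rewrite -scalemx1 -scalemxAr -scalemxAl mulmx1 -map_mxM mulVmx //.
    by rewrite map_mx1 .
  rewrite !det_mulmx mulrAC -det_mulmx -map_mxM mulVmx // map_mx1 det1 mul1r //.
rewrite char_poly_trig ?diag_mx_is_trig //.
by apply: eq_bigr => i _; rewrite mxE eqxx mulr1n.
Qed.

Lemma eigcount_spec n (X : 'M[R]_n) E : X^T = X ->
  eigcount E X = #|specpred (toC X) E%:C%C|.
Proof.
move=> /symmetric_spectrum[d eX dE].
rewrite (@eigcount_split _ _ _ [seq d i | i <- enum 'I_n]); last first.
  by rewrite big_map big_enum.
rewrite count_map cardE size_filter -enumT; apply: eq_count => i /=.
by rewrite /specpred unfold_in dE lecR.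
Qed.

(** The common source of interlacing, monotonicity and shifts, which differ only in the choice of
    [J], [K] and the energies. These data are real, while the test vectors are complex. *)
Lemma eigcount_le n m k (X : 'M[R]_n) (Y : 'M[R]_m) (J : 'M[R]_(n, m))
    (K : 'M[R]_(k, n)) (E E' : R) :
  X^T = X -> Y^T = Y ->
  (forall v : 'rV[R[i]]_n, (v <= map_mx (real_complex R) K)%MS ->
     v *m map_mx (real_complex R) J = 0 -> v = 0) ->
  (forall v : 'rV[R[i]]_n, (v <= map_mx (real_complex R) K)%MS ->
     qform (toC Y) (v *m map_mx (real_complex R) J)
       - E'%:C%C * qform 1%:M (v *m map_mx (real_complex R) J)
       <= qform (toC X) v - E%:C%C * qform 1%:M v) ->
  (eigcount E X + \rank K <= eigcount E' Y + n)%N.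
Proof.
move=> sX sY h1 h2; rewrite !eigcount_spec // -(mxrank_map (real_complex R)).
apply: (@spectral_count_le _ _ _ _ _ _ (map_mx (real_complex R) J)) => //.
- exact: toC_herm.
- exact: toC_herm.
- by rewrite complex_real.
Qed.

Lemma rowsub1_map_mulT n m (f : 'I_n -> 'I_m) : injective f ->
  let J := map_mx (real_complex R) (rowsub f 1%:M) in J *m J ^t* = 1%:M.
Proof.
move=> fi /=; apply/matrixP => i j; rewrite !mxE (bigD1 (f i)) //= !mxE eqxx.
rewrite conj_Creal ?complex_real // big1 => [|k kf].
  rewrite (inj_eq fi) eq_sym; case: eqP => _;
    by rewrite /= ?mulr1n ?mulr0n ?rmorph1 ?rmorph0 ?mul1r ?addr0.
by rewrite !mxE eq_sym (negbTE kf) mulr0n rmorph0 mul0r.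
Qed.

Lemma rowsub1_map_form n m (f : 'I_n -> 'I_m) (Y : 'M[R]_m) :
  let J := map_mx (real_complex R) (rowsub f 1%:M) in
  J *m toC Y *m J ^t* = toC (mxsub f f Y).
Proof.
move=> /=; set J := map_mx _ _.
have -> : J ^t* = map_mx (real_complex R) (colsub f 1%:M).
  apply/matrixP => i j; rewrite !mxE conj_Creal ?complex_real //.
  by rewrite eq_sym.
rewrite /J -!map_mxM; congr map_mx.
rewrite mul_rowsub_mx mul1mx mulmx_colsub mulmx1.
by apply/matrixP => i j; rewrite !mxE.
Qed.

(** Cauchy interlacing: the coordinate inclusion [J] along [f] is an isometry, and compressing [Y]
    by it gives the submatrix. As [f] is any injection, reorderings of the basis are covered too. *)
Lemma eigcount_interlace n m (f : 'I_n -> 'I_m) (Y : 'M[R]_m) E :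
  injective f -> Y^T = Y ->
  (eigcount E (mxsub f f Y) <= eigcount E Y)%N /\
  (eigcount E Y + n <= eigcount E (mxsub f f Y) + m)%N.
Proof.
move=> fi sY; have sX : (mxsub f f Y)^T = mxsub f f Y.
  by rewrite -[in RHS]sY; apply/matrixP => i j; rewrite !mxE.
have JJ := rowsub1_map_mulT fi; have JY := rowsub1_map_form f Y.
set J := map_mx (real_complex R) (rowsub f 1%:M) in JJ JY.
have q1 v : qform (toC Y) (v *m J) = qform (toC (mxsub f f Y)) v.
  by rewrite /qform -JY trmx_mul map_mxM !mulmxA.
have q2 v : qform 1%:M (v *m J) = qform 1%:M v.
  by rewrite /qform !mulmx1 trmx_mul map_mxM !mulmxA -(mulmxA v) JJ mulmx1.
have rJ : \rank (rowsub f 1%:M : 'M[R]_(n, m)) = n.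
  by rewrite -(mxrank_map (real_complex R)) mxrank_unitary //; apply/unitarymxP.
split.
  rewrite -(leq_add2r n) -[X in (_ + X <= _)%N](mxrank1 R n).
  apply: (@eigcount_le _ _ _ _ _ (rowsub f 1%:M)) => // v _; rewrite -/J.
    by move=> /(congr1 (fun u => u *m J ^t*)); rewrite -mulmxA JJ mulmx1 mul0mx.
  by rewrite q1 q2.
(* The reverse comparison uses the transpose of [J] on the row space of [J], of rank [n], where it
   undoes [J]. *)
rewrite -[X in (_ + X <= _)%N]rJ; have JtE : J ^t* = map_mx (real_complex R) (rowsub f 1%:M)^T.
  by apply/matrixP => i j; rewrite !mxE conj_Creal ?complex_real.
apply: (@eigcount_le _ _ _ _ _ (rowsub f 1%:M)^T) => // v /submxP[u ->];
  rewrite -/J -JtE -mulmxA JJ mulmx1.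
  by move=> ->; rewrite mul0mx.
by rewrite q1 q2.
Qed.

Lemma eigcount_diag_mono n (X : 'M[R]_n) (e : 'rV[R]_n) E :
  X^T = X -> (forall i, 0 <= e 0 i) ->
  (eigcount E (X + diag_mx e) <= eigcount E X)%N.
Proof.
move=> sX e0; rewrite -(leq_add2r n) -[X in (_ + X <= _)%N](mxrank1 R n).
apply: (@eigcount_le _ _ _ _ _ 1%:M) => //.
- by rewrite linearD /= sX tr_diag_mx.
- by move=> v _; rewrite map_mx1 mulmx1.
move=> v _; rewrite map_mx1 mulmx1 lerD2r.
rewrite /qform /toC map_mxD mulmxDr mulmxDl [X in _ <= X]mxE lerDl.
rewrite map_diag_mx mul_mx_diag mxE sumr_ge0 // => i _.
by rewrite !mxE mulrAC -normCK mulr_ge0 ?exprn_ge0 // ler0c.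
Qed.

(** Right continuity in the energy: a finite spectrum leaves a gap above [E], and lowering the
    matrix by [eps] amounts to raising the energy by [eps] within that gap. *)
Lemma eigcount_shift n (X : 'M[R]_n) E : X^T = X ->
  exists2 eps, 0 < eps & eigcount E (X - eps%:M) = eigcount E X.
Proof.
move=> sX; have [d eX _] := symmetric_spectrum sX.
have [eps eps0 He] : exists2 eps, 0 < eps & forall i, E < d i -> E + eps < d i.
  (* Halving keeps [E + eps] strictly below each eigenvalue above [E]; the default 1 serves when
     there is none. *)
  pose eps := \big[Num.min/1]_(i | E < d i) ((d i - E) / 2).
  exists eps.
    apply/bigmin_gtP; split => // i Ei; by rewrite divr_gt0 ?subr_gt0.
  move=> i Ei; have : eps <= (d i - E) / 2 by apply: bigmin_le_cond.
  by lra.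
exists eps => //.
have sX' : (X - eps%:M)^T = X - eps%:M.
  by rewrite linearB /= sX tr_scalar_mx.
have qE v : qform (toC (X - eps%:M)) v - E%:C%C * qform 1%:M v
    = qform (toC X) v - (E + eps)%:C%C * qform 1%:M v.
  rewrite /qform /toC map_mxB map_scalar_mx -[(real_complex R eps)%:M]scalemx1.
  rewrite mulmxBr mulmxBl -scalemxAr -scalemxAl.
  have eB (A B : 'M[R[i]]_1) : (A - B) 0 0 = A 0 0 - B 0 0 by rewrite !mxE.
  have eZ c (A : 'M[R[i]]_1) : (c *: A) 0 0 = c * A 0 0 by rewrite !mxE.
  rewrite eB eZ rmorphD /= mulrDl.
  by rewrite opprD addrA [in RHS]addrAC.
have inj1 (v : 'rV[R[i]]_n) : v *m map_mx (real_complex R) 1%:M = 0 -> v = 0.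
  by rewrite map_mx1 mulmx1.
have le1 : (eigcount E (X - eps%:M) + n <= eigcount (E + eps) X + n)%N.
  rewrite -[X in (_ + X <= _)%N](mxrank1 R n).
  apply: (@eigcount_le _ _ _ _ _ 1%:M 1%:M _ _ sX' sX) => v _; first exact: inj1.
  by rewrite map_mx1 mulmx1 qE lexx.
have le2 : (eigcount (E + eps) X + n <= eigcount E (X - eps%:M) + n)%N.
  rewrite -[X in (_ + X <= _)%N](mxrank1 R n).
  apply: (@eigcount_le _ _ _ _ _ 1%:M 1%:M _ _ sX sX') => v _; first exact: inj1.
  by rewrite map_mx1 mulmx1 qE lexx.
have -> : eigcount E (X - eps%:M) = eigcount (E + eps) X.
  by apply/eqP; rewrite eqn_leq; move: le1 le2; rewrite !leq_add2r => -> ->.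
rewrite !(@eigcount_split _ _ _ [seq d i | i <- enum 'I_n]); last first.
- by rewrite big_map big_enum.
- by rewrite big_map big_enum.
rewrite !count_map; apply: eq_count => i /=.
have [Ei|] := ltP E (d i); first by rewrite leNgt He.
by move=> /le_trans -> //; rewrite lerDl ltW.
Qed.
End RealSymmetric.

(** * Counts for a kernel restricted to a list of sites *)

Section KernelCount.
Set Implicit Arguments.
Unset Strict Implicit.
Unset Printing Implicit Defensive.
Variables (R : realType) (T : eqType) (x0 : T) (E : R).
Implicit Types (k : T -> T -> R) (A B : seq T).

(** With a kernel on sites as the basic object, restriction, translation and disjoint union act on
    lists; the order of the sites is absorbed by [kcount_interlace]. *)
Definition kmx k A : 'M[R]_(size A) :=
  \matrix_(i, j) k (nth x0 A i) (nth x0 A j).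

Definition kcount k A := eigcount E (kmx k A).

Lemma eigcount_eq n m (X : 'M[R]_n) (Y : 'M[R]_m) (e : n = m) :
  (forall i j, X i j = Y (cast_ord e i) (cast_ord e j)) ->
  eigcount E X = eigcount E Y.
Proof.
case: m / e Y => Y h; congr eigcount; apply/matrixP => i j.
by rewrite h !cast_ord_id.
Qed.

Lemma kmx_sym k A : (forall x y, k x y = k y x) -> (kmx k A)^T = kmx k A.
Proof. by move=> ks; apply/matrixP => i j; rewrite !mxE ks. Qed.

Lemma eq_kcount k k' A : {in A &, k =2 k'} -> kcount k A = kcount k' A.
Proof.
move=> h; congr eigcount; apply/matrixP => i j.
by rewrite !mxE h ?mem_nth.
Qed.

Lemma kcount_map k f A :
  kcount k (map f A) = kcount (fun x y => k (f x) (f y)) A.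
Proof.
rewrite /kcount; apply: (@eigcount_eq _ _ _ _ (size_map f A)) => i j; rewrite !mxE.
have lt (l : 'I_(size (map f A))) : (l < size A)%N by rewrite -[X in (_ < X)%N](size_map f).
by rewrite !(nth_map x0) ?lt.
Qed.

Lemma kcount_interlace k A B : (forall x y, k x y = k y x) ->
  uniq B -> {subset B <= A} ->
  (kcount k B <= kcount k A)%N /\ (kcount k A + size B <= kcount k B + size A)%N.
Proof.
move=> ks uB sBA.
have iA (i : 'I_(size B)) : (index (nth x0 B i) A < size A)%N.
  by rewrite index_mem sBA ?mem_nth.
pose f i := Ordinal (iA i).
have fi : injective f.
  move=> i j /(congr1 val) /= /(congr1 (nth x0 A)).
  rewrite !nth_index ?sBA ?mem_nth // => /eqP.
  by rewrite nth_uniq // => /eqP/val_inj.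
have -> : kcount k B = eigcount E (mxsub f f (kmx k A)).
  congr eigcount; apply/matrixP => i j; rewrite !mxE /=.
  by rewrite !nth_index ?sBA ?mem_nth.
by apply: eigcount_interlace => //; apply: kmx_sym.
Qed.

(** Interlacing costs one eigenvalue per additional site, and covering the duplicate-free [A] by
    [B ++ C] bounds their number by [size C]. *)
Lemma kcount_approx k A B C : (forall x y, k x y = k y x) ->
  uniq A -> uniq B -> {subset B <= A} -> {subset A <= B ++ C} ->
  (kcount k B <= kcount k A <= kcount k B + size C)%N.
Proof.
move=> ks uA uB sBA sABC; have [-> h] := kcount_interlace ks uB sBA.
have := uniq_leq_size uA sABC; rewrite size_cat; move: h; lia.
Qed.

Lemma kcount_size k A : (forall x y, k x y = k y x) -> (kcount k A <= size A)%N.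
Proof.
move=> ks; rewrite /kcount eigcount_spec ?kmx_sym //.
by rewrite -[X in (_ <= X)%N]card_ord max_card.
Qed.

Lemma char_poly_block n m (X : 'M[R]_n) (Y : 'M[R]_m) :
  char_poly (block_mx X 0 0 Y) = char_poly X * char_poly Y.
Proof.
rewrite /char_poly /char_poly_mx map_block_mx !map_mx0 scalar_mx_block.
by rewrite opp_block_mx add_block_mx !oppr0 !addr0 det_ublock.
Qed.

(** Without coupling the matrix is block diagonal, so its characteristic polynomial factors and the
    two spectra are concatenated. *)
Lemma kcount_cat k A B : (forall x y, k x y = k y x) ->
  (forall x y, x \in A -> y \in B -> k x y = 0) ->
  kcount k (A ++ B) = (kcount k A + kcount k B)%N.
Proof.
move=> ks k0.
have -> : kcount k (A ++ B) = eigcount E (block_mx (kmx k A) 0 0 (kmx k B)).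
  rewrite /kcount; apply: (@eigcount_eq _ _ _ _ (size_cat A B)) => i j; rewrite !mxE !nth_cat.
  (* Matches positions in [A ++ B], as seen by [nth], with positions inside a block, as seen by
     [block_mx]. *)
  have cE (l : 'I_(size (A ++ B))) :
      match fintype.split (cast_ord (size_cat A B) l) with
      | inl l' => (l < size A)%N && (val l == val l')
      | inr l' => ~~ (l < size A)%N && (val l - size A == val l')%N
      end.
    by case: splitP => l' /= ->; rewrite ?ltn_ord ?addKn ?ltnNge ?leq_addr ?eqxx.
  move: (cE i); case: (fintype.split _) => i' /andP[hi /eqP ei];
    rewrite ?hi ?(negbTE hi) !mxE; move: (cE j);
    case: (fintype.split _) => j' /andP[hj /eqP ej];
    rewrite ?hj ?(negbTE hj) !mxE ?ei ?ej //.
    by rewrite k0 ?mem_nth ?ltn_ord.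
  by rewrite ks k0 ?mem_nth ?ltn_ord.
have [dA eA _] := symmetric_spectrum (kmx_sym A ks).
have [dB eB _] := symmetric_spectrum (kmx_sym B ks).
pose s n (d : 'I_n -> R) := [seq d i | i <- enum 'I_n].
have sE n (d : 'I_n -> R) : \prod_i ('X - (d i)%:P) = \prod_(a <- s n d) ('X - a%:P).
  by rewrite big_map big_enum.
rewrite sE in eA; rewrite sE in eB.
rewrite /kcount (eigcount_split _ eA) (eigcount_split _ eB).
rewrite (@eigcount_split _ _ _ _ (s _ dA ++ s _ dB)) ?count_cat //.
by rewrite char_poly_block eA eB big_cat.
Qed.

Definition diagv (e : T -> R) A : 'rV[R]_(size A) := \row_i e (nth x0 A i).

Lemma kmxD k e A : uniq A ->
  kmx (fun x y => k x y + (if x == y then e x else 0)) A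
  = kmx k A + diag_mx (diagv e A).
Proof.
move=> uA; apply/matrixP => i j; rewrite !mxE nth_uniq //.
by rewrite (inj_eq val_inj); case: eqP => [->|]; rewrite ?mulr1n ?mulr0n.
Qed.

Lemma kcount_mono k e A : (forall x y, k x y = k y x) -> uniq A ->
  {in A, forall x, 0 <= e x :> R} ->
  (kcount (fun x y => k x y + (if x == y then e x else 0))%R A <= kcount k A)%N.
Proof.
move=> ks uA e0; rewrite /kcount kmxD //; apply: eigcount_diag_mono.
  exact: kmx_sym.
by move=> i; rewrite mxE e0 ?mem_nth.
Qed.

Lemma kcount_shift k A : (forall x y, k x y = k y x) -> uniq A ->
  exists2 eps, 0 < eps &
    kcount (fun x y => k x y + (if x == y then - eps else 0)) A = kcount k A.
Proof.
move=> ks uA; have [eps e0 h] := eigcount_shift E (kmx_sym A ks).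
exists eps => //; rewrite -[RHS]h /kcount (kmxD k (fun=> - eps)) //.
congr (eigcount E (_ + _)); apply/matrixP => i j; rewrite !mxE.
by case: eqP => _; rewrite ?mulr1n ?mulr0n ?oppr0.
Qed.

End KernelCount.

(** * The Sierpinski graph *)

Section Graph.
Set Implicit Arguments.
Unset Strict Implicit.
Unset Printing Implicit Defensive.

Definition side (n : nat) : int := (2 ^ n)%N%:Z.

Lemma side_gt0 n : 0 < side n. Proof. by rewrite /side ltz_nat expn_gt0. Qed.
Lemma sideS n : side n.+1 = side n + side n.
Proof. by rewrite /side expnS mul2n -addnn PoszD. Qed.

(* The three corners of [Gn n], which are also the three translations
   building [Gn n.+1] from [Gn n]. *)
Definition offs (n : nat) : seq pt := [:: (0, 0); (side n, 0); (0, side n)].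

Definition ptsub (x a : pt) : pt := (x.1 - a.1, x.2 - a.2).

Lemma ptaddK a x : ptsub (ptadd a x) a = x.
Proof. by case: x => i j; congr (_, _) => /=; lia. Qed.

Lemma ptsubK x a : ptadd a (ptsub x a) = x.
Proof. by case: x => i j; congr (_, _) => /=; lia. Qed.

Lemma ptadd_inj a : injective (ptadd a).
Proof. by move=> x y /(congr1 (ptsub^~ a)); rewrite !ptaddK. Qed.

Lemma mirrorK : involutive mirror.
Proof. by case=> i j; congr (_, _) => /=; lia. Qed.

(** The solid triangle of side [h] at [a], in lattice coordinates. It encloses a translate of [Gn],
    so that overlaps of translates reduce to linear inequalities. *)
Definition inT (a : pt) (h : int) (x : pt) : bool :=
  [&& a.1 <= x.1, a.2 <= x.2 & x.1 + x.2 <= a.1 + a.2 + h].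

Lemma tri_cornersS n p : reflect
  (exists2 a, a \in offs n & exists2 q, q \in tri_corners n & p = ptadd a q)
  (p \in tri_corners n.+1).
Proof.
rewrite /= !mem_cat; apply: (iffP or3P).
  move=> [h|/mapP[q h ->]|/mapP[q h ->]].
  - exists (0, 0); rewrite ?inE ?eqxx //; exists p => //.
    by case: p {h} => i j; congr (_, _) => /=; lia.
  - by exists (side n, 0); rewrite ?inE ?eqxx ?orbT //; exists q.
  - by exists (0, side n); rewrite ?inE ?eqxx ?orbT //; exists q.
move=> [a]; rewrite !inE => /or3P[]/eqP -> [q qn ->].
- constructor 1; suff -> : ptadd (0, 0) q = q by [].
  by case: q {qn} => i j; congr (_, _) => /=; lia.
- by constructor 2; apply/mapP; exists q.
- by constructor 3; apply/mapP; exists q.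
Qed.

Lemma tri_verts_add a p x : (ptadd a x \in tri_verts (ptadd a p)) = (x \in tri_verts p).
Proof. by case: a p x => [a b] [i j] [x y]; rewrite !inE !xpair_eqE /=; lia. Qed.

Lemma tri_corners_bound n p : p \in tri_corners n ->
  [&& 0 <= p.1, 0 <= p.2 & p.1 + p.2 + 1 <= side n].
Proof.
elim: n p => [|n IH] p; first by rewrite inE => /eqP ->.
case/tri_cornersS => a + [q /IH + ->]; have := side_gt0 n.
by rewrite sideS !inE => ? /or3P[]/eqP ->; case: q => i j /=; lia.
Qed.

(** A decidable adjacency that sees only the unmirrored triangles of one level; [adjE] shows that
    between points of [Gn n] nothing is missed. *)
Definition ladj n (x y : pt) : bool :=
  (x != y) && has (fun p => (x \in tri_verts p) && (y \in tri_verts p)) (tri_corners n).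

Lemma mem_Gn n x : reflect (exists2 p, p \in tri_corners n & x \in tri_verts p)
  (x \in Gn n).
Proof.
rewrite /Gn mem_undup; apply: (iffP flattenP).
  by move=> [s /mapP[p pn ->] xp]; exists p.
by move=> [p pn xp]; exists (tri_verts p) => //; apply/mapP; exists p.
Qed.

Lemma Gn_uniq n : uniq (Gn n). Proof. exact: undup_uniq. Qed.

Lemma Gn_bound n x : x \in Gn n -> inT (0, 0) (side n) x.
Proof.
case/mem_Gn => p /tri_corners_bound; case: p x => i j [k l].
rewrite /inT /= => h; rewrite !inE !xpair_eqE /=; move: h; lia.
Qed.

Lemma Gn_bound_add n a x : x \in Gn n -> inT a (side n) (ptadd a x).
Proof. by move/Gn_bound; rewrite /inT /ptadd /=; lia. Qed.

Lemma GnS n x : reflect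
  (exists2 a, a \in offs n & exists2 y, y \in Gn n & x = ptadd a y)
  (x \in Gn n.+1).
Proof.
apply: (iffP (mem_Gn _ _)).
  move=> [p /tri_cornersS[a an [q qn ->]]]; rewrite -(ptsubK x a) tri_verts_add => h.
  by exists a => //; exists (ptsub x a) => //; apply/mem_Gn; exists q.
move=> [a an [y /mem_Gn[p pn yp] ->]]; exists (ptadd a p).
  by apply/tri_cornersS; exists a => //; exists p.
by rewrite tri_verts_add.
Qed.

(** A corner of level [n] translated by itself is doubled, and doubling sends the corners of level
    [n] to those of level [n.+1]. *)
Lemma offs_Gn n a : a \in offs n -> a \in Gn n.
Proof.
elim: n a => [|n IH] a; first by rewrite !inE => /or3P[]/eqP ->.
have h b : b \in offs n -> ptadd b b \in Gn n.+1.
  by move=> bn; apply/GnS; exists b => //; exists b => //; apply: IH.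
rewrite !inE => /or3P[]/eqP ->.
- by have := h (0, 0); apply; rewrite !inE.
- have := h (side n, 0); rewrite /ptadd /= addr0 -sideS; apply; by rewrite !inE eqxx orbT.
- have := h (0, side n); rewrite /ptadd /= addr0 -sideS; apply; by rewrite !inE eqxx !orbT.
Qed.

Lemma ladj_Gn n x y : ladj n x y -> (x \in Gn n) && (y \in Gn n).
Proof.
move=> /andP[_ /hasP[p pn /andP[xp yp]]].
by apply/andP; split; apply/mem_Gn; exists p.
Qed.

Lemma ladj_sym n x y : ladj n x y = ladj n y x.
Proof. by rewrite /ladj eq_sym; congr (_ && _); apply: eq_has => p; rewrite andbC. Qed.

Lemma ladjS n x y : reflect
  (exists2 a, a \in offs n & ladj n (ptsub x a) (ptsub y a)) (ladj n.+1 x y).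
Proof.
apply: (iffP idP).
  move=> /andP[xy /hasP[p /tri_cornersS[a an [q qn ->]]]].
  rewrite -{1}(ptsubK x a) -{1}(ptsubK y a) !tri_verts_add => h.
  exists a => //; apply/andP; split; last by apply/hasP; exists q.
  by apply: contraNneq xy => e; rewrite -(ptsubK x a) e ptsubK.
move=> [a an /andP[xy /hasP[p pn h]]]; apply/andP; split.
  by apply: contraNneq xy => ->.
apply/hasP; exists (ptadd a p); first by apply/tri_cornersS; exists a => //; exists p.
by rewrite -{1}(ptsubK x a) -{1}(ptsubK y a) !tri_verts_add.
Qed.

Lemma offs_meet n a b x : a \in offs n -> b \in offs n -> a != b ->
  inT a (side n) x -> inT b (side n) x -> ptsub x a \in offs n.
Proof.
have := side_gt0 n; rewrite /inT /ptsub !inE => z0.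
by case: x => i j; move=> /or3P[]/eqP -> /or3P[]/eqP ->; rewrite !xpair_eqE /=; lia.
Qed.

Lemma offs_meet_eq n a b x y : a \in offs n -> b \in offs n -> a != b ->
  inT a (side n) x -> inT b (side n) x -> inT a (side n) y -> inT b (side n) y -> x = y.
Proof.
have := side_gt0 n; rewrite /inT !inE => z0 an bn ab h1 h2 h3 h4; apply/eqP.
move: an bn ab h1 h2 h3 h4; case: x y => i j [k l].
by move=> /or3P[]/eqP -> /or3P[]/eqP ->; rewrite !xpair_eqE /=; lia.
Qed.

Lemma inT_sub n a x : ptsub x a \in Gn n -> inT a (side n) x.
Proof. by move/(Gn_bound_add a); rewrite ptsubK. Qed.

(* Distinct translates of [Gn n] in [Gn n.+1] share at most one point, so an
   edge with both ends in one translate comes from that translate. *)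
Lemma ladjS_sub n a x y : a \in offs n -> inT a (side n) x -> inT a (side n) y ->
  ladj n.+1 x y = ladj n (ptsub x a) (ptsub y a).
Proof.
move=> an xa ya; apply/ladjS/idP => [[b bn h]|h]; last by exists a.
have [->|ab] := eqVneq a b; first exact: h.
have /andP[/inT_sub xb /inT_sub yb] := ladj_Gn h.
by move: h; rewrite (offs_meet_eq an bn ab xa xb ya yb) /ladj eqxx.
Qed.

Lemma ptsub0 x : ptsub x (0, 0) = x.
Proof. by case: x => i j; congr (_, _) => /=; lia. Qed.

(** At each later level [Gn n] stays inside the lower-left translate, where by [ladjS_sub] no new
    edge appears. This settles the level hidden in the existential of [adj]. *)
Lemma ladj_stable n m x y : x \in Gn n -> y \in Gn n -> (n <= m)%N ->
  ladj m x y = ladj n x y.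
Proof.
move=> /Gn_bound xn /Gn_bound yn /subnKC <-; elim: (m - n)%N => [|k IH].
  by rewrite addn0.
rewrite addnS (@ladjS_sub _ (0, 0)) ?inE ?eqxx // ?ptsub0 //.
  by move: xn; rewrite /inT /side expnD; have := side_gt0 k; rewrite /side; nia.
by move: yn; rewrite /inT /side expnD; have := side_gt0 k; rewrite /side; nia.
Qed.

Lemma adjP x y : adj x y <-> exists n, ladj n x y \/ ladj n (mirror x) (mirror y).
Proof.
have mm u p : (u \in map mirror (tri_verts p)) = (mirror u \in tri_verts p).
  by rewrite -{1}(mirrorK u) mem_map //; apply: inv_inj mirrorK.
split.
  move=> [/eqP xy [n [p pn h]]]; exists n; case: h => [h|h]; [left|right].
    by apply/andP; split => //; apply/hasP; exists p.
  apply/andP; split; first by rewrite (inj_eq (inv_inj mirrorK)).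
  by apply/hasP; exists p; rewrite -?mm.
move=> [n [/andP[xy /hasP[p pn h]]|/andP[xy /hasP[p pn h]]]]; split.
- exact/eqP.
- by exists n, p => //; left.
- by move: xy; rewrite (inj_eq (inv_inj mirrorK)) => /eqP.
- by exists n, p => //; right; rewrite !mm.
Qed.

Lemma adj_sym x y : adj x y <-> adj y x.
Proof.
by rewrite !adjP; split => -[n h]; exists n; rewrite ladj_sym (ladj_sym n (mirror _)).
Qed.

Lemma adj_mirror x y : adj (mirror x) (mirror y) <-> adj x y.
Proof. by rewrite !adjP; split => -[n h]; exists n; rewrite !mirrorK in h *; case: h; auto. Qed.

Lemma mirror_Gn0 n m x : x \in Gn n -> mirror x \in Gn m -> x = (0, 0).
Proof.
move=> /Gn_bound + /Gn_bound; case: x => i j; rewrite /inT /= => h1 h2.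
by congr (_, _); move: h1 h2; lia.
Qed.

(** A mirrored edge with both ends in the right half would have both ends at the origin by
    [mirror_Gn0], although the ends of an edge differ. *)
Lemma adjE n x y : x \in Gn n -> y \in Gn n -> adj x y <-> ladj n x y.
Proof.
move=> xn yn; rewrite adjP; split; last by exists n; left.
move=> [m [h|h]].
  have [nm|/ltnW mn] := leqP n m; first by rewrite -(ladj_stable xn yn nm).
  by have /andP[xm ym] := ladj_Gn h; rewrite (ladj_stable xm ym mn).
have /andP[xm ym] := ladj_Gn h.
by move: h; rewrite (mirror_Gn0 xn xm) (mirror_Gn0 yn ym) /ladj eqxx.
Qed.

End Graph.

(** * Truncated triangles: decomposition, cardinality and degrees *)

Section TruncatedTriangle.
Set Implicit Arguments.
Unset Strict Implicit.
Unset Printing Implicit Defensive.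

Lemma mem_Gtilde n x : (x \in Gtilde n) = (x \in Gn n) && (x \notin offs n).
Proof. by rewrite mem_filter andbC. Qed.

Lemma Gtilde_uniq n : uniq (Gtilde n).
Proof. exact/filter_uniq/Gn_uniq. Qed.

Lemma ptadd_Gn n a x : a \in offs n -> x \in Gn n -> ptadd a x \in Gn n.+1.
Proof. by move=> an xn; apply/GnS; exists a => //; exists x. Qed.

Lemma adj_shift n a x y : a \in offs n -> x \in Gn n -> y \in Gn n ->
  adj (ptadd a x) (ptadd a y) <-> adj x y.
Proof.
move=> an xn yn; rewrite (adjE (ptadd_Gn an xn) (ptadd_Gn an yn)) (adjE xn yn).
by rewrite (ladjS_sub an (Gn_bound_add a xn) (Gn_bound_add a yn)) !ptaddK.
Qed.

Lemma Gtilde_translates_disjoint n a b x y : a \in offs n -> b \in offs n -> a != b ->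
  x \in Gtilde n -> y \in Gn n -> ptadd a x <> ptadd b y.
Proof.
move=> an bn ab; rewrite mem_Gtilde => /andP[xn xo] yn e.
have xa := Gn_bound_add a xn; have yb := Gn_bound_add b yn.
rewrite -e in yb; have := offs_meet an bn ab xa yb.
by rewrite ptaddK (negbTE xo).
Qed.

(** An edge of the larger triangle lies in one translate [c], which differs from [a] or from [b].
    One end would then belong to two translates, hence be a corner of its own copy. *)
Lemma adj_translates n a b x y : a \in offs n -> b \in offs n -> a != b ->
  x \in Gtilde n -> y \in Gtilde n -> ~ adj (ptadd a x) (ptadd b y).
Proof.
move=> an bn ab xt yt.
have [xn yn] : x \in Gn n /\ y \in Gn n.
  by move: xt yt; rewrite !mem_Gtilde => /andP[? _] /andP[? _].
rewrite (adjE (ptadd_Gn an xn) (ptadd_Gn bn yn)) => /ladjS[c cn /ladj_Gn/andP[h1 h2]].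
have [e|ac] := eqVneq a c.
  rewrite -e in h2 cn.
  have ba : b != a by rewrite eq_sym.
  by apply: (Gtilde_translates_disjoint bn an ba yt h2); rewrite ptsubK.
by apply: (Gtilde_translates_disjoint an cn ac xt h1); rewrite ptsubK.
Qed.

(** The junctions where two translates touch, that is, the midpoints of the sides of the next
    triangle. *)
Definition mids n : seq pt := [:: (side n, 0); (0, side n); (side n, side n)].

Lemma mids_uniq n : uniq (mids n).
Proof. by have := side_gt0 n; rewrite /= !inE !xpair_eqE; lia. Qed.

Definition Gtilde3 n : seq pt :=
  map (ptadd (0, 0)) (Gtilde n) ++
  (map (ptadd (side n, 0)) (Gtilde n) ++ map (ptadd (0, side n)) (Gtilde n)).

Lemma mem_Gtilde3 n x : reflect
  (exists2 a, a \in offs n & exists2 y, y \in Gtilde n & x = ptadd a y)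
  (x \in Gtilde3 n).
Proof.
rewrite /Gtilde3 !mem_cat; apply: (iffP or3P).
  move=> [] /mapP[y yn ->]; [exists (0, 0)|exists (side n, 0)|exists (0, side n)];
  by rewrite ?inE ?eqxx ?orbT //; exists y.
move=> [a]; rewrite !inE => /or3P[]/eqP -> [y yn ->].
- by constructor 1; apply/mapP; exists y.
- by constructor 2; apply/mapP; exists y.
- by constructor 3; apply/mapP; exists y.
Qed.

Lemma offs_neq n : [/\ (0, 0) != (side n, 0) :> pt, (0, 0) != (0, side n) :> pt &
  (side n, 0) != (0, side n) :> pt].
Proof. by have := side_gt0 n; rewrite !xpair_eqE => ?; split; lia. Qed.

Lemma offs_mem n : [/\ (0, 0) \in offs n, (side n, 0) \in offs n & (0, side n) \in offs n].
Proof. by rewrite !inE !eqxx !orbT. Qed.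

Lemma Gtilde3_uniq n : uniq (Gtilde3 n).
Proof.
have [n1 n2 n3] := offs_neq n; have [q1 q2 q3] := offs_mem n.
have disj a b : a \in offs n -> b \in offs n -> a != b ->
    has (mem (map (ptadd a) (Gtilde n))) (map (ptadd b) (Gtilde n)) = false.
  move=> an bn ab; apply/negbTE/hasPn => x /mapP[y yt ->]; apply/negP => /mapP[y' yt' e].
  have y'n : y' \in Gn n by move: yt'; rewrite mem_Gtilde => /andP[].
  have ba : b != a by rewrite eq_sym.
  by apply: (Gtilde_translates_disjoint bn an ba yt y'n).
rewrite !cat_uniq !map_inj_uniq ?Gtilde_uniq //=; try exact: ptadd_inj.
by rewrite has_cat !disj.
Qed.

(** Of the nine corners of the translates, three are the removed corners of the next triangle and
    the other six coincide in pairs at [mids]. *)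
Lemma Gtilde_recE n : perm_eq (Gtilde n.+1) (Gtilde3 n ++ mids n).
Proof.
have zp := side_gt0 n; have eS := sideS n.
apply: uniq_perm; first exact: Gtilde_uniq.
  rewrite cat_uniq Gtilde3_uniq mids_uniq andbT andTb; apply/hasPn => x xm.
  apply/negP => /mem_Gtilde3[a an [y]]; rewrite mem_Gtilde => /andP[yn yo] xE.
  move/Gn_bound: yn; move: yo an xm; rewrite xE !inE /inT /ptadd.
  case: y {xE} => k l; move=> yo /or3P[]/eqP -> /=; move: yo; rewrite !xpair_eqE /=;
   lia.
move=> x; rewrite mem_cat; apply/idP/orP.
  rewrite mem_Gtilde => /andP[/GnS[a an [y yn ->]] xo].
  have [yo|yo] := boolP (y \in offs n); last first.
    by left; apply/mem_Gtilde3; exists a => //; exists y => //; rewrite mem_Gtilde yn.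
  right; move: xo an yo; rewrite !inE => xo /or3P[]/eqP aE /or3P[]/eqP yE;
  move: xo; rewrite aE yE /ptadd !xpair_eqE /= ?eS; lia.
case=> [/mem_Gtilde3[a an [y]]|xm].
  rewrite !mem_Gtilde => /andP[yn yo] ->; rewrite ptadd_Gn //=.
  move: an yo (Gn_bound yn); rewrite !inE /inT; case: y {yn} => k l /or3P[]/eqP ->;
  rewrite !xpair_eqE /= ?eS; lia.
rewrite mem_Gtilde; apply/andP; split.
  have [q1 q2 q3] := offs_mem n.
  move: xm; rewrite !inE => /or3P[]/eqP ->.
  - by have := ptadd_Gn q1 (offs_Gn q2); rewrite /ptadd /= !add0r.
  - by have := ptadd_Gn q1 (offs_Gn q3); rewrite /ptadd /= !add0r.
  - by have := ptadd_Gn q2 (offs_Gn q3); rewrite /ptadd /= !add0r addr0.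
move: xm; rewrite !inE => /or3P[]/eqP ->; rewrite !xpair_eqE ?eS; lia.
Qed.

(** Solves [s' = 3 * s + 3], starting from the empty truncated triangle of level 0. *)
Lemma size_Gtilde n : (2 * size (Gtilde n) + 3 = 3 ^ n.+1)%N.
Proof.
elim: n => [|n IH]; first by [].
rewrite (perm_size (Gtilde_recE n)) /Gtilde3 !size_cat !size_map expnS -IH /=.
lia.
Qed.

Lemma Gn_Gtilde n : perm_eq (Gn n) (Gtilde n ++ offs n).
Proof.
apply: uniq_perm; first exact: Gn_uniq.
  rewrite cat_uniq Gtilde_uniq andTb; apply/andP; split.
    by apply/hasPn => x xo; rewrite mem_Gtilde negb_and negbK xo orbT.
  by have := side_gt0 n; rewrite /= !inE !xpair_eqE; lia.
move=> x; rewrite mem_cat mem_Gtilde; have [/offs_Gn ->|] := boolP (x \in offs n).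
  by rewrite orbT.
by rewrite andbT orbF.
Qed.

Lemma size_Gn n : size (Gn n) = (size (Gtilde n) + 3)%N.
Proof. by rewrite (perm_size (Gn_Gtilde n)) size_cat. Qed.

Definition ldeg n x := count (ladj n ^~ x) (Gn n).

Lemma degA_ldeg n x : x \in Gn n -> degA (Gn n) x = ldeg n x.
Proof.
move=> xn; apply: eq_in_count => y yn /=.
by apply/asboolP/idP => /(adjE yn xn).
Qed.

(** The edges of level [n.+1] split disjointly among the three translates, since two translates
    share no pair of distinct points. *)
Lemma ldegS n x : ldeg n.+1 x = (\sum_(a <- offs n) ldeg n (ptsub x a))%N.
Proof.
have E a : a \in offs n ->
    ldeg n (ptsub x a) = count (fun y => ladj n (ptsub y a) (ptsub x a)) (Gn n.+1).
  move=> an; rewrite /ldeg -!size_filter -(size_map (ptadd a)).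
  apply: perm_size; apply: uniq_perm.
  - by rewrite map_inj_uniq ?filter_uniq ?Gn_uniq //; exact: ptadd_inj.
  - by rewrite filter_uniq ?Gn_uniq.
  move=> y; rewrite mem_filter; apply/mapP/andP => [[u]|[h yn]].
    by rewrite mem_filter => /andP[h un] ->; rewrite ptaddK ptadd_Gn.
  exists (ptsub y a); last by rewrite ptsubK.
  by rewrite mem_filter h; have /andP[] := ladj_Gn h.
rewrite big_seq; under eq_bigr => a an do rewrite E //.
rewrite -big_seq /ldeg; elim: (Gn n.+1) => [|y s IH]; first by rewrite big1.
rewrite /= IH big_split /=; congr (_ + _)%N.
have [q1 q2 q3] := offs_mem n; have [n1 n2 n3] := offs_neq n.
have excl a b : a \in offs n -> b \in offs n -> a != b ->
    ladj n (ptsub y a) (ptsub x a) -> ladj n (ptsub y b) (ptsub x b) -> False.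
  move=> an bn ab h1 h2.
  have /andP[/inT_sub ya /inT_sub xa] := ladj_Gn h1.
  have /andP[/inT_sub yb /inT_sub xb] := ladj_Gn h2.
  by move: h1; rewrite (offs_meet_eq an bn ab ya yb xa xb) /ladj eqxx.
have -> : ladj n.+1 y x = has (fun a => ladj n (ptsub y a) (ptsub x a)) (offs n).
  by apply/ladjS/hasP => -[a an h]; exists a.
rewrite /= !big_cons big_nil addn0.
move: (excl _ _ q1 q2 n1) (excl _ _ q1 q3 n2) (excl _ _ q2 q3 n3).
by case: (ladj _ _ _) => //=; case: (ladj _ _ _) => //=; case: (ladj _ _ _) => //=;
  try (by move=> /(_ isT isT)); try (by move=> _ /(_ isT isT));
  try (by move=> _ _ /(_ isT isT)).
Qed.

Lemma ldeg_out n x : x \notin Gn n -> ldeg n x = 0%N.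
Proof.
move=> xn; rewrite /ldeg; apply/eqP; rewrite -leqn0 leqNgt -has_count.
by apply/hasPn => y _; apply: contra xn => /ladj_Gn/andP[].
Qed.

(** Away from the corners, a site either lies in a single translate with degree 4 there, or joins
    two translates and gets degree 2 from each. Degree 4 is where the three boundary conditions have
    the same diagonal, as [2 * 4 - 4 = 4]. *)
Lemma ldegE n x : x \in Gn n -> ldeg n x = if x \in offs n then 2%N else 4%N.
Proof.
elim: n x => [|n IH] x xn.
  have : x \in [:: (0, 0); (1, 0); (0, 1) : pt] by rewrite -[_ \in _]/(x \in Gn 0).
  by rewrite !inE => /or3P[]/eqP ->.
have zp := side_gt0 n; have eS := sideS n.
have [q1 q2 q3] := offs_mem n.
have out a : ~~ inT a (side n) x -> ldeg n (ptsub x a) = 0%N.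
  by move=> h; apply: ldeg_out; apply: contra h; apply: inT_sub.
have off y : y \in offs n -> ldeg n y = 2%N.
  by move=> yo; rewrite IH ?yo ?offs_Gn.
rewrite ldegS !big_cons big_nil addn0.
have [xo|xo] := boolP (x \in offs n.+1).
  move: xo out; rewrite !inE => /or3P[]/eqP -> out.
  - rewrite off ?[ldeg n (ptsub _ (side n, 0))]out ?[ldeg n (ptsub _ (0, side n))]out //;
      rewrite /inT /ptsub /= ?inE ?subrr //; lia.
  - rewrite [ldeg n (ptsub _ (0, 0))]out ?[ldeg n (ptsub _ (0, side n))]out ?off //;
      rewrite /inT /ptsub /= ?eS ?inE ?addrK ?subrr ?eqxx ?orbT //; lia.
  - rewrite [ldeg n (ptsub _ (0, 0))]out ?[ldeg n (ptsub _ (side n, 0))]out ?off //;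
      rewrite /inT /ptsub /= ?eS ?inE ?addrK ?subrr ?eqxx ?orbT //; lia.
have : x \in Gtilde n.+1 by rewrite mem_Gtilde xn.
rewrite (perm_mem (Gtilde_recE n)) mem_cat => /orP[/mem_Gtilde3[a an [y yt xE]]|].
  have y4 : ldeg n y = 4%N by move: yt; rewrite mem_Gtilde => /andP[/IH -> /negbTE ->].
  have ob b : b \in offs n -> a != b -> ldeg n (ptsub x b) = 0%N.
    move=> bn ab; apply: ldeg_out; apply/negP => h.
    by apply: (Gtilde_translates_disjoint an bn ab yt h); rewrite ptsubK xE.
  have [n1 n2 n3] := offs_neq n.
  have xa : ldeg n (ptsub x a) = 4%N by rewrite xE ptaddK.
  move: an ob xa; rewrite !inE => /or3P[]/eqP -> ob xa.
  - by rewrite xa (ob (side n, 0)) // (ob (0, side n)).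
  - by rewrite xa (ob (0, 0)) 1?eq_sym // (ob (0, side n)).
  - by rewrite xa (ob (0, 0)) 1?eq_sym // (ob (side n, 0)) 1?eq_sym.
move: out; rewrite !inE => out /or3P[]/eqP xE; rewrite xE in out *.
- rewrite [ldeg n (ptsub _ (0, side n))]out ?off //;
    rewrite /inT /ptsub /= ?inE ?subrr ?subr0 ?eqxx ?orbT //; lia.
- rewrite [ldeg n (ptsub _ (side n, 0))]out ?off //;
    rewrite /inT /ptsub /= ?inE ?subrr ?subr0 ?eqxx ?orbT //; lia.
- rewrite [ldeg n (ptsub _ (0, 0))]out ?off //;
    rewrite /inT /ptsub /= ?inE ?subrr ?subr0 ?eqxx ?orbT //; lia.
Qed.

End TruncatedTriangle.

(** * The mirrored half, and degrees in the ball and near the corners *)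

Section Mirror.
Set Implicit Arguments.
Unset Strict Implicit.
Unset Printing Implicit Defensive.

Lemma ladj_sides n m x y : x \in Gn n -> mirror y \in Gn n -> x != (0, 0) -> y != (0, 0) ->
  ~~ ladj m x y.
Proof.
move=> xn yn x0 y0; apply/negP => /ladj_Gn/andP[_ ym].
by move: y0; rewrite (mirror_Gn0 ym yn).
Qed.

(** Every edge lies within one of the two halves, and these share only the origin. *)
Lemma adj_sides n x y : x \in Gn n -> mirror y \in Gn n -> x != (0, 0) ->
  adj x y -> y = (0, 0).
Proof.
move=> xn yn x0; have [//|y0] := eqVneq y (0, 0).
have m0 u : u != (0, 0) -> mirror u != (0, 0).
  apply: contraNneq => mu; by rewrite -(mirrorK u) mu.
case/adjP => m [h|]; first by have := ladj_sides m xn yn x0 y0; rewrite h.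
rewrite ladj_sym => h; have := @ladj_sides n m (mirror y) (mirror x) yn.
by rewrite mirrorK h => /(_ xn (m0 _ y0) (m0 _ x0)).
Qed.

Lemma BL_uniq L : uniq (BL L). Proof. exact: undup_uniq. Qed.

Lemma mem_BL L x : (x \in BL L) = (x \in Gn L) || (mirror x \in Gn L).
Proof.
rewrite /BL mem_undup mem_cat /Gn' -{2}(mirrorK x) mem_map //.
exact: inv_inj mirrorK.
Qed.

Lemma Gtilde_neq0 L x : x \in Gtilde L -> x != (0, 0).
Proof. by rewrite mem_Gtilde !inE !negb_or => /andP[_ /andP[]]. Qed.

Lemma Gtilde_Gn L x : x \in Gtilde L -> x \in Gn L.
Proof. by rewrite mem_Gtilde => /andP[]. Qed.

Lemma degA_Gn L x : x \in Gtilde L -> degA (Gn L) x = 4%N.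
Proof.
move=> xt; rewrite degA_ldeg ?(Gtilde_Gn xt) // ldegE ?(Gtilde_Gn xt) //.
by move: xt; rewrite mem_Gtilde => /andP[_ /negbTE ->].
Qed.

Lemma eq_degA A B x y : perm_eq A (map mirror B) ->
  x = mirror y -> degA A x = degA B y.
Proof.
move=> /permP pAB ->; rewrite /degA pAB count_map; apply: eq_count => u /=.
by apply/asboolP/asboolP => /adj_mirror.
Qed.

(** By [adj_sides] a neighbour on the mirrored side can only be the origin, which already belongs to
    [Gn L]. *)
Lemma degA_BL L x : x \in Gtilde L -> degA (BL L) x = 4%N.
Proof.
move=> xt; rewrite -(degA_Gn xt) /degA -!size_filter; apply: perm_size.
apply: uniq_perm; rewrite ?filter_uniq ?BL_uniq ?Gn_uniq // => y.
rewrite !mem_filter mem_BL; case: asboolP => //= ayx.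
have [//|yn] := boolP (y \in Gn L); apply/negP => myn.
have axy : adj x y by apply/adj_sym.
have y0 := adj_sides (Gtilde_Gn xt) myn (Gtilde_neq0 xt) axy.
by move: yn; rewrite y0 offs_Gn // inE eqxx.
Qed.

Lemma BL_mirror L : perm_eq (BL L) (map mirror (BL L)).
Proof.
have mi : injective mirror by apply: inv_inj mirrorK.
apply: uniq_perm; rewrite ?map_inj_uniq ?BL_uniq // => x.
by rewrite -[x in RHS]mirrorK mem_map // !mem_BL mirrorK orbC.
Qed.

Lemma degA_BL_mirror L x : x \in Gtilde L -> degA (BL L) (mirror x) = 4%N.
Proof. by move=> xt; rewrite -(degA_BL xt); apply: eq_degA (BL_mirror L) _. Qed.

(** Contains every site of [Gtilde L] that loses a neighbour with the corners; two neighbours per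
    corner give the bound 6 below. *)
Definition corner_nbrs L : seq pt :=
  [seq y <- Gn L | has (fun c => `[< adj y c >]) (offs L)].

Lemma size_corner_nbrs L : (size (corner_nbrs L) <= 6)%N.
Proof.
have [q1 q2 q3] : [/\ (0, 0) \in offs L, (side L, 0) \in offs L & (0, side L) \in offs L].
  exact: offs_mem.
have d c : c \in offs L -> count (fun y => `[< adj y c >]) (Gn L) = 2%N.
  by move=> co; rewrite -/(degA _ _) degA_ldeg ?offs_Gn // ldegE ?co ?offs_Gn.
have := d _ q1; have := d _ q2; have := d _ q3; rewrite size_filter.
have cU (p q : pred pt) s : (count (predU p q) s <= count p s + count q s)%N.
  by rewrite -count_predUI leq_addr.
move=> h3 h2 h1; apply: leq_trans (cU (fun y => `[< adj y (0, 0) >])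
  (fun y => has (fun c => `[< adj y c >]) (behead (offs L))) _) _.
rewrite h1 -[6%N]/(2 + 4)%N leq_add2l.
apply: leq_trans (cU (fun y => `[< adj y (side L, 0) >])
  (fun y => has (fun c => `[< adj y c >]) (behead (behead (offs L)))) _) _.
rewrite h2 -[4%N]/(2 + 2)%N leq_add2l -[X in (_ <= X)%N]h3.
by rewrite (eq_count (a2 := fun y => `[< adj y (0, side L) >])) // => y /=; rewrite orbF.
Qed.

Lemma degA_Gtilde L x : x \in Gtilde L -> x \notin corner_nbrs L ->
  degA (Gtilde L) x = 4%N.
Proof.
move=> xt xc; rewrite -(degA_Gn xt) /degA -!size_filter; apply: perm_size.
apply: uniq_perm; rewrite ?filter_uniq ?Gtilde_uniq ?Gn_uniq // => y.
rewrite [LHS]mem_filter [RHS]mem_filter mem_Gtilde; case: asboolP => //= ayx.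
case: (boolP (y \in offs L)) => [yo|]; rewrite ?andbT // andbF.
apply/esym/negP => yn; move: xc; rewrite mem_filter (Gtilde_Gn xt) andbT.
by move/hasPn/(_ y yo)/asboolPn => /=; apply; apply/adj_sym.
Qed.
End Mirror.

(** * Deterministic comparison of counts across regions and boundary conditions *)

Section Reduction.
Set Implicit Arguments.
Unset Strict Implicit.
Unset Printing Implicit Defensive.
Variables (R : realType) (E : R).
Implicit Types (v : pt -> R) (A B : seq pt).

Definition hker (dg : pt -> nat) v (x y : pt) : R :=
  (if x == y then (dg x)%:R + v x else 0) - (if `[< adj x y >] then 1 else 0).

Lemma hker_sym dg v x y : hker dg v x y = hker dg v y x.
Proof.
rewrite /hker eq_sym; congr (_ - _); first by case: eqP => // ->.
by congr (if _ then _ else _); apply/asboolP/asboolP => /adj_sym.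
Qed.

(** The simple boundary condition: the kernel is the same for all [A], so shrinking [A] gives a
    principal submatrix and moving [A] by a graph isomorphism amounts to moving the potential. *)
Definition ncount A v : nat := kcount (0, 0) E (hker (fun=> 4%N) v) A.

Lemma eigcount_Hmx b A v : uniq A ->
  eigcount E (Hmx b A v) = kcount (0, 0) E (hker (diag_term b A) v) A.
Proof.
move=> uA; congr eigcount; apply/matrixP => i j.
by rewrite !mxE /hker nth_uniq // (inj_eq val_inj).
Qed.

(** Deleting [C] leaves sites of degree 4, on which the kernels of all boundary conditions coincide.
    Both counts thus exceed the same count on the remaining sites by at most [size C]. *)
Lemma ncount_bc b A v (C : seq pt) : uniq A ->
  (forall x, x \in A -> x \notin C -> degA A x = 4%N) ->
  (eigcount E (Hmx b A v) <= ncount A v + size C)%N /\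
  (ncount A v <= eigcount E (Hmx b A v) + size C)%N.
Proof.
move=> uA dA; rewrite eigcount_Hmx //.
pose B := [seq x <- A | x \notin C].
have uB : uniq B by apply: filter_uniq.
have sBA : {subset B <= A} by move=> x; rewrite mem_filter => /andP[].
have sAB : {subset A <= B ++ C}.
  by move=> x xA; rewrite mem_cat mem_filter xA andbT orNb.
have eB : kcount (0, 0) E (hker (diag_term b A) v) B = ncount B v.
  apply: eq_kcount => x y; rewrite mem_filter => /andP[xC xA] _.
  by rewrite /hker; congr ((if _ then _%:R + _ else _) - _); case: b => //=; rewrite dA.
have := kcount_approx (0, 0) E (@hker_sym (diag_term b A) v) uA uB sBA sAB.
have := kcount_approx (0, 0) E (@hker_sym (fun=> 4%N) v) uA uB sBA sAB.
rewrite eB -/(ncount A v) -/(ncount B v).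
move: (ncount A v) (ncount B v) (kcount _ _ _ A) (size C) => p q r s; lia.
Qed.

Lemma ncount_map A v f : {in A &, injective f} ->
  {in A &, forall x y, adj (f x) (f y) <-> adj x y} ->
  ncount (map f A) v = ncount A (v \o f).
Proof.
move=> fi fa; rewrite /ncount kcount_map; apply: eq_kcount => x y xA yA.
rewrite /hker; have -> : `[< adj (f x) (f y) >] = `[< adj x y >].
  by have [h1 h2] := fa x y xA yA; apply/asboolP/asboolP.
by rewrite (inj_in_eq fi).
Qed.

Lemma ncount_offs n a v : a \in offs n ->
  ncount (map (ptadd a) (Gtilde n)) v = ncount (Gtilde n) (v \o ptadd a).
Proof.
move=> an; apply: ncount_map => [x y _ _|x y /Gtilde_Gn xn /Gtilde_Gn yn].
  exact: ptadd_inj.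
exact: (adj_shift an xn yn).
Qed.

Lemma ncount_cat A B v : (forall x y, x \in A -> y \in B -> x <> y /\ ~ adj x y) ->
  ncount (A ++ B) v = (ncount A v + ncount B v)%N.
Proof.
move=> h; apply: kcount_cat => [x y|x y xA yB]; first exact: hker_sym.
have [/eqP/negbTE xy /asboolPn/negbTE nadj] := h x y xA yB.
by rewrite /hker xy nadj subrr.
Qed.

(** The count is exactly additive on [Gtilde3 n]; the 3 is the number of junction sites [mids n]. *)
Lemma ncount_rec n v :
  let s := (ncount (Gtilde n) (v \o ptadd (0%R, 0%R))
    + ncount (Gtilde n) (v \o ptadd (side n, 0%R))
    + ncount (Gtilde n) (v \o ptadd (0%R, side n)))%N in
  (s <= ncount (Gtilde n.+1) v <= s + 3)%N.
Proof.
have [q1 q2 q3] := offs_mem n; have [n1 n2 n3] := offs_neq n.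
have sep a b x y : a \in offs n -> b \in offs n -> a != b ->
    x \in map (ptadd a) (Gtilde n) -> y \in map (ptadd b) (Gtilde n) ->
    x <> y /\ ~ adj x y.
  move=> an bn ab /mapP[x' xt ->] /mapP[y' yt ->]; split.
    exact: Gtilde_translates_disjoint an bn ab xt (Gtilde_Gn yt).
  exact: adj_translates an bn ab xt yt.
have -> /= : (ncount (Gtilde n) (v \o ptadd (0%R, 0%R))
    + ncount (Gtilde n) (v \o ptadd (side n, 0%R))
    + ncount (Gtilde n) (v \o ptadd (0%R, side n)))%N = ncount (Gtilde3 n) v.
  rewrite /Gtilde3 ncount_cat => [|x y xA].
    rewrite ncount_cat ?ncount_offs ?addnA // => x y; exact: sep.
  by rewrite mem_cat => /orP[]; apply: sep xA.
have pm := perm_mem (Gtilde_recE n).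
apply: (@kcount_approx _ _ _ _ _ _ _ (mids n)).
- exact: hker_sym.
- exact: Gtilde_uniq.
- exact: Gtilde3_uniq.
- by move=> x x3; rewrite pm mem_cat x3.
- by move=> x; rewrite pm.
Qed.

(** For [Gn L] the 6 is 3 for the boundary condition at the corners plus 3 for deleting them; for
    [Gtilde L] it is the bound on [corner_nbrs L]. *)
Lemma ncount_T L b A v : A = Gn L \/ A = Gtilde L ->
  (eigcount E (Hmx b A v) <= ncount (Gtilde L) v + 6)%N /\
  (ncount (Gtilde L) v <= eigcount E (Hmx b A v) + 6)%N.
Proof.
case=> ->.
  have := @ncount_bc b (Gn L) v (offs L) (Gn_uniq L); case=> [x xn xo|].
    by apply: degA_Gn; rewrite mem_Gtilde xn.
  have : (ncount (Gtilde L) v <= ncount (Gn L) v <= ncount (Gtilde L) v + 3)%N.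
    have pm := perm_mem (Gn_Gtilde L).
    apply: (@kcount_approx _ _ _ _ _ _ _ (offs L)).
    - exact: hker_sym.
    - exact: Gn_uniq.
    - exact: Gtilde_uniq.
    - exact: Gtilde_Gn.
    - by move=> x; rewrite pm.
  have -> : size (offs L) = 3%N by [].
  by move: (ncount (Gn L) v) (ncount (Gtilde L) v) (eigcount _ _) => p q r; lia.
have := @ncount_bc b (Gtilde L) v (corner_nbrs L) (Gtilde_uniq L) (@degA_Gtilde L).
have := size_corner_nbrs L.
by move: (size _) (ncount _ v) (eigcount _ _) => p q r; lia.
Qed.

Definition Gsym L : seq pt := Gtilde L ++ map mirror (Gtilde L).
Definition corners2 L : seq pt := offs L ++ map mirror (offs L).

Lemma Gsym_uniq L : uniq (Gsym L).
Proof.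
have mi : injective mirror by apply: inv_inj mirrorK.
rewrite cat_uniq Gtilde_uniq map_inj_uniq // Gtilde_uniq andbT andTb.
apply/hasPn => x /mapP[y yt ->]; apply/negP => /Gtilde_Gn h.
by have := Gtilde_neq0 yt; rewrite (mirror_Gn0 (Gtilde_Gn yt) h) eqxx.
Qed.

Lemma Gsym_BL L : {subset Gsym L <= BL L} /\ {subset BL L <= Gsym L ++ corners2 L}.
Proof.
have mi : injective mirror by apply: inv_inj mirrorK.
split=> x.
  rewrite mem_cat mem_BL => /orP[/Gtilde_Gn -> //|/mapP[y /Gtilde_Gn yn ->]].
  by rewrite mirrorK yn orbT.
have mm (A : seq pt) u : (u \in map mirror A) = (mirror u \in A).
  by rewrite -{1}(mirrorK u) mem_map.
rewrite mem_BL !mem_cat !mm !mem_Gtilde.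
by case: (x \in Gn L); case: (mirror x \in Gn L); case: (x \in offs L);
  case: (mirror x \in offs L).
Qed.

Lemma size_BL L : (2 * size (Gtilde L) <= size (BL L) <= 2 * size (Gtilde L) + 6)%N.
Proof.
have [s1 s2] := Gsym_BL L.
have := uniq_leq_size (Gsym_uniq L) s1; have := uniq_leq_size (BL_uniq L) s2.
rewrite /Gsym /corners2 !size_cat !size_map [size (offs L)]/=.
by move: (size (BL L)) (size (Gtilde L)) => p q; lia.
Qed.

(** The 12 is twice the length of [corners2 L], once for changing the boundary condition and once
    for deleting these sites. The origin is among them, so the remaining halves are unlinked. *)
Lemma ncount_BL L b v :
  let s := (ncount (Gtilde L) v + ncount (Gtilde L) (v \o mirror))%N in
  (eigcount E (Hmx b (BL L) v) <= s + 12)%N /\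
  (s <= eigcount E (Hmx b (BL L) v) + 12)%N.
Proof.
have [s1 s2] := Gsym_BL L.
have -> /= : (ncount (Gtilde L) v + ncount (Gtilde L) (v \o mirror))%N = ncount (Gsym L) v.
  rewrite /Gsym ncount_cat.
    rewrite [in RHS]ncount_map // => [x y _ _|x y _ _]; first exact: (inv_inj mirrorK).
    exact: adj_mirror.
  move=> x y xt /mapP[y' yt ->].
  have my0 : mirror y' <> (0, 0).
    by move=> /(congr1 mirror)/eqP; rewrite mirrorK (negbTE (Gtilde_neq0 yt)).
  have myn : mirror (mirror y') \in Gn L by rewrite mirrorK Gtilde_Gn.
  split; last by move=> /(adj_sides (Gtilde_Gn xt) myn (Gtilde_neq0 xt)).
  by move=> e; have := Gtilde_Gn xt; rewrite e => /mirror_Gn0/(_ myn).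
have := @ncount_bc b (BL L) v (corners2 L) (BL_uniq L); case=> [x|].
  move=> /s2; rewrite mem_cat => /orP[xs _|-> //].
  by move: xs; rewrite mem_cat => /orP[/degA_BL//|/mapP[y /degA_BL_mirror + ->]].
have : (ncount (Gsym L) v <= ncount (BL L) v <= ncount (Gsym L) v + size (corners2 L))%N.
  apply: kcount_approx => //; [exact: hker_sym|exact: BL_uniq|exact: Gsym_uniq].
have -> : size (corners2 L) = 6%N by [].
by move: (ncount (BL L) v) (ncount (Gsym L) v) (eigcount _ _) => p q r; lia.
Qed.

Lemma ncount_size A v : (ncount A v <= size A)%N.
Proof. exact/kcount_size/hker_sym. Qed.

End Reduction.

(** * Independence of counts on disjoint sites *)

Section Cylinders.
Set Implicit Arguments.
Unset Strict Implicit.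
Unset Printing Implicit Defensive.
Variable R : realType.

(** Rectangles over the sites of [s], the events described by [iid]. Being closed under
    intersection, they determine laws on the events that depend on the potential at these sites. *)
Definition cyl (s : seq pt) : set_system (pt -> R) :=
  [set C | exists2 B : pt -> set R, (forall x, measurable (B x)) &
    C = [set v | forall x, x \in s -> B x (v x)]].

Lemma cyl_setI s : setI_closed (cyl s).
Proof.
move=> _ _ [B mB ->] [B' mB' ->]; exists (fun x => B x `&` B' x).
  by move=> x; apply: measurableI.
apply/seteqP; split=> v /=; first by move=> [h h'] x xs; split; [apply: h|apply: h'].
by move=> h; split=> x /h [].
Qed.

Lemma cyl_setT s : cyl s setT.
Proof. by exists (fun=> setT) => //; apply/seteqP; split. Qed.

(** Finite lists of rationals form a countable type, so these potentials can index a countable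
    union. *)
Definition rational_pot (A : seq pt) (q : seq rat) (x : pt) : R :=
  ratr (nth 0 q (index x A)).

(* The count decreases when the potential increases and is unchanged by a
   small downward shift, so the sublevel set is the union of the orthants above
   its rational points. *)
Lemma kcount_cylinder E dg (A : seq pt) k : uniq A ->
  <<s cyl A >> [set v | (kcount (0%R, 0%R) E (hker dg v) A <= k)%N].
Proof.
move=> uA.
pose N v := kcount (0, 0) E (hker dg v) A.
have mono v w : {in A, forall x, v x <= w x} -> (N w <= N v)%N.
  move=> vw; rewrite /N.
  rewrite (eq_kcount (0, 0) E (k' := fun x y =>
    hker dg v x y + (if x == y then w x - v x else 0))); last first.
    by move=> x y _ _; rewrite /hker; case: eqP => _; ring.
  apply: kcount_mono => // [x y|x xA]; first exact: hker_sym.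
  by rewrite subr_ge0 vw.
pose O q := [set v | forall x, x \in A -> rational_pot A q x <= v x].
have -> : [set v | (N v <= k)%N]
    = \bigcup_q (if (N (rational_pot A q) <= k)%N then O q else set0).
  apply/seteqP; split=> v /=; last first.
    move=> [q _]; case: ifP => // qk /= h; apply: leq_trans qk.
    exact: mono.
  (* A rational potential between [v - eps] and [v] on [A] has [v] in its orthant, and its count is
     at most that of [v - eps], which equals that of [v]. *)
  move=> vk; have [eps e0 he] := kcount_shift (0, 0) E (hker_sym dg v) uA.
  have /choice[f fE] : forall x, exists q : rat, v x - eps < ratr q < v x.
    move=> x; have /rat_in_itvoo[q] : v x - eps < v x by rewrite ltrBlDr ltrDl.
    by rewrite in_itv /= => h; exists q.
  pose q := map f A.
  have qE x : x \in A -> rational_pot A q x = ratr (f x).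
    by move=> xA; rewrite /rational_pot (nth_map (0, 0)) ?index_mem // nth_index.
  exists q => //.
  have qk : (N (rational_pot A q) <= k)%N.
    apply: leq_trans vk; rewrite [N v](_ : _ = N (fun x => v x - eps)).
      by apply: mono => x xA; rewrite qE // ltW //; case/andP: (fE x).
    rewrite /N -he; apply: eq_kcount => x y _ _.
    by rewrite /hker; case: eqP => _; ring.
  by rewrite qk => x xA; rewrite qE // ltW //; case/andP: (fE x).
apply: (@countable_bigcupT_measurable _ (g_sigma_algebraType (cyl A))) => [|q].
  exact: countableP.
case: ifP => _; last exact: (@measurable0 _ (g_sigma_algebraType (cyl A))).
apply: sub_sigma_algebra; exists (fun x => [set` `[rational_pot A q x, +oo[]) => //.
by apply/seteqP; split=> v /= h x /h; rewrite in_itv /= andbT.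
Qed.

End Cylinders.

Section Independence.
Set Implicit Arguments.
Unset Strict Implicit.
Unset Printing Implicit Defensive.
Context (d : measure_display) (T : measurableType d) (R : realType).
Variable (P : probability T R).

(** The auxiliary event [D] lets one induction serve twice: [D = setT] compares the laws of [X] and
    [Y], and [X = Y] gives independence from [D]. *)
Lemma dynkin_cyl (s : seq pt) (X Y : T -> pt -> R) (D : set T) :
  measurable D ->
  (forall C, cyl s C -> [/\ measurable (X @^-1` C), measurable (Y @^-1` C) &
     P (X @^-1` C `&` D) = (P D * P (Y @^-1` C))%E]) ->
  forall C, <<s cyl s >> C -> [/\ measurable (X @^-1` C), measurable (Y @^-1` C) &
     P (X @^-1` C `&` D) = (P D * P (Y @^-1` C))%E].
Proof.
move=> mD h.
apply: (@dynkin_induction _ (g_sigma_algebraType (cyl s)) (cyl s)) => //.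
- exact: cyl_setI.
- exact/h/cyl_setT.
- move=> S _ [mX mY e].
  have eX : X @^-1` (~` S) = ~` (X @^-1` S) by [].
  have eY : Y @^-1` (~` S) = ~` (Y @^-1` S) by [].
  rewrite eX eY.
  split; [exact: measurableC|exact: measurableC|].
  rewrite setIC -setDE.
  have -> : P (D `\` X @^-1` S) = (P D - P (D `&` X @^-1` S))%E.
    apply: measureD => //.
    by rewrite (le_lt_trans (probability_le1 _ _)) ?ltry.
  rewrite probability_setC //.
  have -> : P (D `&` X @^-1` S) = (P D * P (Y @^-1` S))%E by rewrite setIC; exact: e.
  have fD : P D \is a fin_num by apply: fin_num_measure.
  by rewrite muleBr // ?mule1 // fin_num_adde_defr.
- move=> F mF tF h'; have hX n : measurable (X @^-1` F n) by have [] := h' n.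
  have hY n : measurable (Y @^-1` F n) by have [] := h' n.
  have eX : X @^-1` (\bigcup_k F k) = \bigcup_k (X @^-1` F k) by apply/seteqP; split.
  have eY : Y @^-1` (\bigcup_k F k) = \bigcup_k (Y @^-1` F k) by apply/seteqP; split.
  rewrite eX eY; split; [exact: bigcup_measurable|exact: bigcup_measurable|].
  have -> : P (\bigcup_k (X @^-1` F k) `&` D) = (\sum_(k <oo) P (X @^-1` F k `&` D))%E.
    rewrite setI_bigcupl; apply: measure_semi_bigcup.
    - by move=> n; apply: measurableI.
    - by move=> i j _ _ [w [[wi _] [wj _]]]; apply: tF => //; exists (X w).
    - by apply: bigcup_measurable => n _; apply: measurableI.
  have -> : P (\bigcup_k (Y @^-1` F k)) = (\sum_(k <oo) P (Y @^-1` F k))%E.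
    apply: measure_semi_bigcup => //; last exact: bigcup_measurable.
    by move=> i j _ _ [w [wi wj]]; apply: tF => //; exists (Y w).
  have fD : P D \is a fin_num by apply: fin_num_measure.
  rewrite -(fineK fD) -nneseriesZl //.
  by apply: eq_eseriesr => n _; rewrite fineK //; have [] := h' n.
Qed.

Variable V : pt -> T -> R.
Hypothesis iidV : iid P inG V.

Definition law (B : set R) : \bar R := P (V (0, 0) @^-1` B).

Lemma inG0 : inG (0, 0). Proof. by exists 0%N; left. Qed.

(** Here the sets are indexed by [I], whereas [iid] indexes them by sites; since images are
    distinct, [B'] recovers the index from the position of a site in [map f u]. The empty family is
    treated apart because [nth] needs a default index. *)
Lemma iid_prod (I : eqType) (u : seq I) (f : I -> pt) (B : I -> set R) :
  uniq (map f u) -> (forall i, i \in u -> inG (f i)) ->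
  (forall i, measurable (B i)) ->
  P [set w | forall i, i \in u -> B i (V (f i) w)] = (\prod_(i <- u) law (B i))%E.
Proof.
case: iidV => mV lawV prodV; case: u => [|i0 u'].
  move=> _ _ _; rewrite big_nil -(@probability_setT _ _ _ P); congr (P _).
  by apply/seteqP; split.
set u := i0 :: u' => uf uG mB.
pose B' y := B (nth i0 u (index y (map f u))).
have B'E i : i \in u -> B' (f i) = B i.
  move=> iu; rewrite /B'; congr B; have fu : f i \in map f u by apply: map_f.
  have lt : (index (f i) (map f u) < size u)%N by rewrite -(size_map f) index_mem.
  have /uniqP -/(_ (f i0)) inj := uf.
  have := nth_index (f i0) fu; rewrite (nth_map i0) // => e.
  have le : (index i u < size u)%N by rewrite index_mem.
  have : index (f i) (map f u) = index i u.
    apply: inj; rewrite ?inE ?size_map // !(nth_map i0) // nth_index //.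
  by move=> ->; rewrite nth_index.
have -> : [set w | forall i, i \in u -> B i (V (f i) w)]
    = \bigcap_(y in [set` map f u]) (V y @^-1` B' y).
  apply/seteqP; split=> w /= h.
    move=> y yu; have /mapP[i iu ->] : y \in map f u by [].
    by rewrite /preimage /mkset B'E //; apply: h.
  move=> i iu; have := h (f i) (map_f f iu).
  by rewrite /preimage /mkset B'E.
rewrite prodV // => [|x /mapP[i iu ->]|x]; last exact: mB.
  rewrite big_map big_seq [RHS]big_seq; apply: eq_bigr => i iu.
  rewrite B'E // /law; apply: lawV => //; [exact: uG|exact: inG0].
exact: uG.
Qed.

Definition pull (f : pt -> pt) (w : T) : pt -> R := fun x => V (f x) w.

Lemma pull_measurable f s C : (forall x, x \in s -> inG (f x)) -> cyl s C ->
  measurable (pull f @^-1` C).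
Proof.
case: iidV => mV _ _ fG [B mB ->].
have -> : pull f @^-1` [set v | forall x, x \in s -> B x (v x)]
   = \bigcap_(x in [set` s]) (V (f x) @^-1` B x).
  by apply/seteqP; split.
apply: fin_bigcap_measurable => // x /= xs.
by rewrite -[X in measurable X]setTI; apply: mV => //; apply: fG.
Qed.

Lemma pull_ident f g s : uniq (map f s) -> uniq (map g s) ->
  (forall x, x \in s -> inG (f x)) -> (forall x, x \in s -> inG (g x)) ->
  forall C, <<s cyl s >> C -> measurable (pull f @^-1` C) /\
    P (pull f @^-1` C) = P (pull g @^-1` C).
Proof.
move=> uf ug fG gG C sC.
have [] := @dynkin_cyl s (pull f) (pull g) setT measurableT _ C sC; last first.
  by rewrite setIT probability_setT mul1e.
move=> {sC}C cC; split; try exact: pull_measurable cC.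
rewrite setIT probability_setT mul1e; case: cC => B mB ->.
by rewrite (iid_prod uf fG mB) (iid_prod ug gG mB).
Qed.

(** Dynkin's argument runs twice: first in [C] with [C'] a rectangle, then in [C'] with [C]
    arbitrary. *)
Lemma pull_indep f g s : uniq (map f s ++ map g s) ->
  (forall x, x \in s -> inG (f x)) -> (forall x, x \in s -> inG (g x)) ->
  forall C C', <<s cyl s >> C -> <<s cyl s >> C' ->
    P (pull f @^-1` C `&` pull g @^-1` C') =
    (P (pull f @^-1` C) * P (pull g @^-1` C'))%E.
Proof.
rewrite cat_uniq => /and3P[uf dfg ug] fG gG.
have ufg : uniq (map f s ++ map g s) by rewrite cat_uniq uf dfg.
have mf C : <<s cyl s >> C -> measurable (pull f @^-1` C).
  by move=> /(pull_ident uf uf fG fG)[].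
have mg C : <<s cyl s >> C -> measurable (pull g @^-1` C).
  by move=> /(pull_ident ug ug gG gG)[].
have step1 C C' : cyl s C -> cyl s C' -> P (pull f @^-1` C `&` pull g @^-1` C') =
    (P (pull f @^-1` C) * P (pull g @^-1` C'))%E.
  case=> B mB -> [B' mB' ->].
  (* A Boolean tag is needed because the same [x] carries two sets, one for [f x] and one for
     [g x]. *)
  pose u := [seq (true, x) | x <- s] ++ [seq (false, x) | x <- s].
  pose F (i : bool * pt) := if i.1 then f i.2 else g i.2.
  pose BB (i : bool * pt) := if i.1 then B i.2 else B' i.2.
  have uE : map F u = map f s ++ map g s by rewrite map_cat -!map_comp.
  have := @iid_prod _ u F BB; rewrite uE ufg => /(_ isT).
  have h1 : forall i, i \in u -> inG (F i).
    by move=> i; rewrite mem_cat => /orP[]/mapP[x xs ->]; [apply: fG|apply: gG].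
  have h2 i : measurable (BB i) by rewrite /BB; case: ifP.
  move=> /(_ h1 h2); rewrite big_cat !big_map /= -(iid_prod uf fG mB).
  rewrite -(iid_prod ug gG mB') => <-; congr (P _); apply/seteqP; split=> w /=.
    move=> [hf hg] i; rewrite mem_cat => /orP[]/mapP[x xs ->]; [exact: hf|exact: hg].
  move=> h; split=> x xs.
    by apply: (h (true, x)); rewrite mem_cat map_f.
  by apply: (h (false, x)); rewrite mem_cat [X in _ || X]map_f // orbT.
have step2 C C' : <<s cyl s >> C -> cyl s C' -> P (pull f @^-1` C `&` pull g @^-1` C') =
    (P (pull f @^-1` C) * P (pull g @^-1` C'))%E.
  move=> sC cC'.
  have [] // := @dynkin_cyl s (pull f) (pull f) (pull g @^-1` C') _ _ C sC.
  - exact: pull_measurable gG cC'.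
  - move=> C0 cC0; split; try exact: pull_measurable cC0.
    by rewrite step1 // muleC.
  - by move=> _ _ ->; rewrite muleC.
move=> C C' sC sC'.
have [] // := @dynkin_cyl s (pull g) (pull g) (pull f @^-1` C) _ _ C' sC'.
- exact: mf.
- move=> C0 cC0; split; try exact: pull_measurable cC0.
  by rewrite setIC step2.
- by move=> _ _; rewrite setIC.
Qed.

End Independence.

(** * Bounded random variables *)

Section BoundedExpectation.
Set Implicit Arguments.
Unset Strict Implicit.
Unset Printing Implicit Defensive.
Context (d : measure_display) (T : measurableType d) (R : realType).
Variable (P : probability T R).
Implicit Types f g : T -> R.

Definition bmeas f := measurable_fun setT f /\ exists M, forall w, `|f w| <= M.

Lemma bmeas_cst c : bmeas (fun=> c).
Proof. by split => //; exists `|c|. Qed.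

Lemma bmeasD f g : bmeas f -> bmeas g -> bmeas (fun w => f w + g w).
Proof.
move=> [mf [M bf]] [mg [N bg]]; split; first exact: measurable_funD.
by exists (M + N) => w; apply: le_trans (ler_normD _ _) (lerD (bf w) (bg w)).
Qed.

Lemma bmeasM f g : bmeas f -> bmeas g -> bmeas (fun w => f w * g w).
Proof.
move=> [mf [M bf]] [mg [N bg]]; split; first exact: measurable_funM.
by exists (M * N) => w; rewrite normrM ler_pM.
Qed.

Lemma bmeasB f g : bmeas f -> bmeas g -> bmeas (fun w => f w - g w).
Proof.
move=> [mf [M bf]] [mg [N bg]]; split; first exact: measurable_funB.
by exists (M + N) => w; apply: le_trans (ler_normB _ _) (lerD (bf w) (bg w)).
Qed.

Lemma bmeas_integrable f : bmeas f -> P.-integrable setT (EFin \o f).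
Proof.
move=> [mf [M bf]]; apply: measurable_bounded_integrable => //.
  by rewrite -ge0_fin_numE ?measure_ge0 // fin_num_measure.
exists M; split; first exact: num_real.
by move=> N MN w _ /=; apply: le_trans (bf w) (ltW MN).
Qed.

Definition Ex f : R := \int[P]_w f w.

Lemma expectation_Ex f : bmeas f -> 'E_P[f]%E = (Ex f)%:E.
Proof.
move=> /bmeas_integrable h; rewrite unlock /Ex /Rintegral fineK //.
exact: integrable_fin_num.
Qed.

Lemma ExD f g : bmeas f -> bmeas g -> Ex (fun w => f w + g w) = Ex f + Ex g.
Proof. by move=> bf bg; apply: RintegralD => //; exact: bmeas_integrable. Qed.

Lemma ExB f g : bmeas f -> bmeas g -> Ex (fun w => f w - g w) = Ex f - Ex g.
Proof. by move=> bf bg; apply: RintegralB => //; exact: bmeas_integrable. Qed.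

Lemma ExZ c f : bmeas f -> Ex (fun w => c * f w) = c * Ex f.
Proof. by move=> bf; apply: RintegralZl => //; exact: bmeas_integrable. Qed.

Lemma Ex_cst c : Ex (fun=> c) = c.
Proof.
rewrite /Ex Rintegral_cst // -[RHS]mulr1; congr (_ * _).
exact: (congr1 fine (probability_setT P)).
Qed.

Lemma le_Ex f g : bmeas f -> bmeas g -> (forall w, f w <= g w) -> Ex f <= Ex g.
Proof. by move=> bf bg fg; apply: le_Rintegral => //; exact: bmeas_integrable. Qed.

Lemma eq_Ex f g : f =1 g -> Ex f = Ex g.
Proof. by move=> fg; congr Ex; apply/funext. Qed.

Lemma bmeas_indic (A : set T) : measurable A -> bmeas \1_A.
Proof.
move=> mA; split; first exact: measurable_indic.
by exists 1 => w; rewrite indicE; case: (w \in A); rewrite /= ?normr1 ?normr0.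
Qed.

Lemma Ex_indic (A : set T) : measurable A -> Ex \1_A = fine (P A).
Proof. 
by move=> mA; rewrite /Ex /Rintegral integral_indic //; congr (fine (P _)); rewrite setIT.
 Qed.

Lemma bmeas_sum (I : eqType) (r : seq I) (F : I -> T -> R) :
  (forall i, i \in r -> bmeas (F i)) -> bmeas (fun w => \sum_(i <- r) F i w).
Proof.
elim: r => [|i r IH] h.
  by rewrite (_ : (fun=> _) = fun=> 0); [exact: bmeas_cst|apply/funext => w; rewrite big_nil].
rewrite (_ : (fun=> _) = fun w => F i w + \sum_(j <- r) F j w); last first.
  by apply/funext => w; rewrite big_cons.
apply: bmeasD; first by apply: h; rewrite inE eqxx.
by apply: IH => j jr; apply: h; rewrite inE jr orbT.
Qed.

Lemma Ex_sum (I : eqType) (r : seq I) (F : I -> T -> R) :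
  (forall i, i \in r -> bmeas (F i)) ->
  Ex (fun w => \sum_(i <- r) F i w) = \sum_(i <- r) Ex (F i).
Proof.
elim: r => [|i r IH] h.
  by rewrite big_nil -[RHS](Ex_cst 0); apply: eq_Ex => w; rewrite big_nil.
have hr j : j \in r -> bmeas (F j) by move=> jr; apply: h; rewrite inE jr orbT.
rewrite big_cons -IH // -ExD; first by apply: eq_Ex => w; rewrite big_cons.
  by apply: h; rewrite inE eqxx.
exact: bmeas_sum.
Qed.

(** Equality of laws and independence are known for events only. This formula turns moments of
    bounded counts into finite sums of probabilities of superlevel sets. *)
Lemma layer_cake (M n : nat) : (n <= M)%N ->
  n%:R = \sum_(k <- iota 0 M) (k < n)%N%:R :> R.
Proof.
move=> nM; rewrite -natr_sum; congr _%:R.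
rewrite -[in LHS](subn0 n) -(size_iota 0 (n - 0)) -sum1_size.
rewrite -(subnKC nM) iotaD big_cat /= add0n subn0 [X in (_ + X)%N]big1_seq ?addn0.
  by rewrite big_seq [RHS]big_seq; apply: eq_bigr => k; rewrite mem_iota /= add0n => ->.
by move=> k /andP[_]; rewrite mem_iota => /andP[nk _]; rewrite ltnNge nk.
Qed.

Lemma bmeas_nat (F : T -> nat) M : (forall k, measurable [set w | (k < F w)%N]) ->
  (forall w, (F w <= M)%N) -> bmeas (fun w => (F w)%:R).
Proof.
move=> mF FM.
rewrite (_ : (fun=> _) = fun w => \sum_(k <- iota 0 M) \1_[set w | (k < F w)%N] w).
  by apply: bmeas_sum => k _; exact: bmeas_indic.
apply/funext => w; rewrite (layer_cake (FM w)); apply: eq_bigr => k _.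
by rewrite indicE mem_setE.
Qed.

Lemma Ex_nat (F : T -> nat) M : (forall k, measurable [set w | (k < F w)%N]) ->
  (forall w, (F w <= M)%N) ->
  Ex (fun w => (F w)%:R) = \sum_(k <- iota 0 M) fine (P [set w | (k < F w)%N]).
Proof.
move=> mF FM.
transitivity (Ex (fun w => \sum_(k <- iota 0 M) \1_[set w | (k < F w)%N] w)).
  apply: eq_Ex => w; rewrite (layer_cake (FM w)); apply: eq_bigr => k _.
  by rewrite indicE mem_setE.
rewrite Ex_sum; first by apply: eq_bigr => k _; exact: Ex_indic.
by move=> k _; exact: bmeas_indic.
Qed.

Lemma Ex_natM (F G : T -> nat) M : (forall k, measurable [set w | (k < F w)%N]) ->
  (forall k, measurable [set w | (k < G w)%N]) ->
  (forall w, (F w <= M)%N) -> (forall w, (G w <= M)%N) ->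
  Ex (fun w => (F w)%:R * (G w)%:R) = \sum_(k <- iota 0 M) \sum_(l <- iota 0 M)
    fine (P ([set w | (k < F w)%N] `&` [set w | (l < G w)%N])).
Proof.
move=> mF mG FM GM.
have mI k l : measurable ([set w | (k < F w)%N] `&` [set w | (l < G w)%N]).
  exact: measurableI.
transitivity (Ex (fun w => \sum_(k <- iota 0 M) \sum_(l <- iota 0 M)
    \1_([set w | (k < F w)%N] `&` [set w | (l < G w)%N]) w)).
  apply: eq_Ex => w; rewrite (layer_cake (FM w)) (layer_cake (GM w)) mulr_suml.
  apply: eq_bigr => k _; rewrite mulr_sumr; apply: eq_bigr => l _.
  by rewrite indicI /= !indicE !mem_setE.
rewrite Ex_sum; last by move=> k _; apply: bmeas_sum => l _; exact: bmeas_indic.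
apply: eq_bigr => k _; rewrite Ex_sum; last by move=> l _; exact: bmeas_indic.
by apply: eq_bigr => l _; exact: Ex_indic.
Qed.

Lemma Ex_sqr_sum3 (X Y Z : T -> R) v : bmeas X -> bmeas Y -> bmeas Z ->
  Ex (fun w => X w * X w) = v -> Ex (fun w => Y w * Y w) = v ->
  Ex (fun w => Z w * Z w) = v -> Ex (fun w => X w * Y w) = 0 ->
  Ex (fun w => X w * Z w) = 0 -> Ex (fun w => Y w * Z w) = 0 ->
  Ex (fun w => (X w + Y w + Z w) ^+ 2) = 3 * v.
Proof.
move=> bX bY bZ xx yy zz xy xz yz.
have bc2 := bmeas_cst 2.
have bxx := bmeasM bX bX; have byy := bmeasM bY bY; have bzz := bmeasM bZ bZ.
have bxy := bmeasM bX bY; have bxz := bmeasM bX bZ; have byz := bmeasM bY bZ.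
transitivity (Ex (fun w => (X w * X w + Y w * Y w + Z w * Z w) +
    2 * (X w * Y w + X w * Z w + Y w * Z w))).
  by apply: eq_Ex => w; ring.
have b1 := bmeasD (bmeasD bxx byy) bzz; have b2 := bmeasD (bmeasD bxy bxz) byz.
rewrite (ExD b1 (bmeasM bc2 b2)) (ExZ 2 b2).
rewrite (ExD (bmeasD bxx byy) bzz) (ExD bxx byy) (ExD (bmeasD bxy bxz) byz) (ExD bxy bxz).
by rewrite xx yy zz xy xz yz; ring.
Qed.

(* [\sum_n (Y n / 3 ^+ n) ^+ 2] has finite expectation, hence is almost
   surely finite. *)
Lemma ae_cvg0 (Y : nat -> T -> R) : (forall n, bmeas (Y n)) ->
  (forall n, Ex (fun w => (Y n w) ^+ 2) <= 4 * 6 ^+ n) ->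
  {ae P, forall w, (fun n => Y n w / 3 ^+ n) @ \oo --> 0}.
Proof.
move=> bY hY.
pose u n w := (Y n w / 3 ^+ n) ^+ 2.
have bu n : bmeas (u n).
  have b := bmeasM (bY n) (bmeas_cst (3 ^+ n)^-1).
  by rewrite /u; under eq_fun do rewrite expr2; exact: (bmeasM b b).
have u0 n w : 0 <= u n w by rewrite /u sqr_ge0.
(* The normalisation enters squared, so the ratio is [6 / 9 = 2 / 3] and the series is dominated by
   a geometric one. *)
have Eu n : Ex (u n) <= 4 * (2 / 3) ^+ n.
  have -> : Ex (u n) = ((3 ^+ n)^-1) ^+ 2 * Ex (fun w => (Y n w) ^+ 2).
    rewrite -ExZ; first by apply: eq_Ex => w; rewrite /u exprMn mulrC.
    by under eq_fun do rewrite expr2; exact: bmeasM.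
  apply: (le_trans (ler_wpM2l _ (hY n))); first by rewrite sqr_ge0.
  rewrite le_eqVlt; apply/orP; left; apply/eqP.
  rewrite -exprVn -exprM mulnC exprM mulrCA -exprMn; congr (_ * _ ^+ _).
  by field.
pose S w : \bar R := (\sum_(n <oo) (u n w)%:E)%E.
have mu_ n : measurable_fun setT (EFin \o u n).
  by apply/measurable_EFinP; case: (bu n).
have S0 w : (0 <= S w)%E by apply: nneseries_ge0 => n _ _; rewrite lee_fin.
have intS : (\int[P]_w S w < +oo)%E.
  rewrite /S integral_nneseries //; last by move=> n w _; rewrite lee_fin.
  apply: (@le_lt_trans _ _ (4 / (1 - 2 / 3))%:E); last exact: ltry.
  apply: lime_le.
    by apply: is_cvg_nneseries => n _ _; apply: integral_ge0 => w _; rewrite lee_fin.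
  near=> n.
  have -> : (\sum_(0 <= k < n) \int[P]_w (u k w)%:E = (\sum_(0 <= k < n) Ex (u k))%:E)%E.
    rewrite -sumEFin; apply: eq_bigr => k _; rewrite /Ex /Rintegral fineK //.
    exact/integrable_fin_num/bmeas_integrable.
  rewrite lee_fin; apply: le_trans (geometric_le_lim n _ _ _) => //; last first.
    by rewrite ger0_norm; lra.
  by apply: ler_sum => k _; exact: Eu.
have iS : P.-integrable setT S.
  apply/integrableP; split.
    by apply: ge0_emeasurable_sum => [n w _ _|n _]; [rewrite lee_fin|exact: mu_].
  by under eq_integral do rewrite gee0_abs //.
apply: filterS (integrable_ae measurableT iS) => w /(_ I) Sfin.
have cvgu : cvgn (series (u ^~ w)).
  apply: nnseries_is_cvg => //.
  by rewrite -/(S w) -ge0_fin_numE.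
have u_0 := cvg_series_cvg_0 cvgu.
apply: norm_cvg0.
have -> : (fun n => `|Y n w / 3 ^+ n|) = (fun n => Num.sqrt (u n w)).
  by apply/funext => n; rewrite /u sqrtr_sqr.
rewrite -[X in _ --> X]sqrtr0.
apply: continuous_cvg u_0; exact: sqrt_continuous.
Unshelve. all: by end_near.
Qed.

End BoundedExpectation.

(** * Limits along powers of 3 with bounded errors *)

Section Limits.
Set Implicit Arguments.
Unset Strict Implicit.
Unset Printing Implicit Defensive.
Variable R : realType.
Implicit Types a b s e : nat -> R.

Lemma bounded_over_exp e (K : R) : (forall n, `|e n| <= K) ->
  (fun n => e n / 3 ^+ n) @ \oo --> 0.
Proof.
move=> eK; apply: norm_cvg0.
have h0 : (fun n => K * (3^-1 : R) ^+ n) @ \oo --> 0.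
  rewrite -(mulr0 K); apply: cvgMr; apply: cvg_expr.
  by rewrite ger0_norm ?invr_ge0 // invf_lt1 // ltr1n.
apply: (squeeze_cvgr _ (cvg_cst 0) h0).
near=> n; rewrite normr_ge0 /= normrM normfV normrX (ger0_norm (_ : 0 <= 3)) //.
by rewrite -exprVn ler_wpM2r ?exprn_ge0 ?invr_ge0.
Unshelve. all: by end_near.
Qed.

Lemma exp_cvg_perturb a b (l K : R) : (forall n, `|a n - b n| <= K) ->
  (fun n => b n / 3 ^+ n) @ \oo --> l -> (fun n => a n / 3 ^+ n) @ \oo --> l.
Proof.
move=> /bounded_over_exp h0 bl.
rewrite (_ : (fun n => a n / 3 ^+ n) =
  (fun n => (a n - b n) / 3 ^+ n) \+ (fun n => b n / 3 ^+ n)); last first.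
  by apply/funext => n /=; rewrite -mulrDl subrK.
by rewrite -[l]add0r; exact: cvgD.
Qed.

(** After division by [3 ^ n] the bounded errors in numerator and denominator vanish, leaving [l]
    and the volume constant [c]. *)
Lemma ratio_cvg a b s (l c K K' : R) : c != 0 -> (forall n, `|a n - b n| <= K) ->
  (forall n, `|s n - c * 3 ^+ n| <= K') ->
  (fun n => b n / 3 ^+ n) @ \oo --> l -> (fun n => a n / s n) @ \oo --> l / c.
Proof.
move=> c0 ab sc bl.
have p0 n : 3 ^+ n != 0 :> R by rewrite expf_neq0.
have ca := exp_cvg_perturb ab bl.
have cs : (fun n => s n / 3 ^+ n) @ \oo --> c.
  apply: (exp_cvg_perturb sc); rewrite (_ : (fun n => _) = fun=> c).
    exact: cvg_cst.
  by apply/funext => n; rewrite mulfK.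
rewrite (_ : (fun n => a n / s n) = (fun n => a n / 3 ^+ n) \* (fun n => (s n / 3 ^+ n)^-1)).
  by apply: cvgM => //; apply: cvgV.
by apply/funext => n /=; rewrite invf_div mulrA mulfVK.
Qed.

End Limits.

(** * Mean, variance and almost sure limit of the counts *)

Section Main.
Set Implicit Arguments.
Unset Strict Implicit.
Unset Printing Implicit Defensive.
Context (d : measure_display) (T : measurableType d) (R : realType).
Variables (P : probability T R) (V : pt -> T -> R) (E : R).
Hypothesis iidV : iid P inG V.

Local Notation Ex := (Ex P).

Lemma Gn_inG n x : x \in Gn n -> inG x.
Proof. by move=> xn; exists n; left. Qed.

Lemma mirror_inG n x : x \in Gn n -> inG (mirror x).
Proof. by move=> xn; exists n; right; apply: map_f. Qed.

Lemma kcount_measurable dg f (A : seq pt) k : uniq (map f A) ->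
  (forall x, x \in A -> inG (f x)) ->
  measurable [set w | (k < kcount (0%R, 0%R) E (hker dg (pull V f w)) A)%N].
Proof.
move=> uf fG; have uA := map_uniq uf.
have [m _] := pull_ident iidV uf uf fG fG (kcount_cylinder E dg k uA).
rewrite (_ : [set w | _] = ~` (pull V f @^-1`
  [set v | (kcount (0%R, 0%R) E (hker dg v) A <= k)%N])); first exact: measurableC.
by apply/seteqP; split=> w /=; rewrite ltnNge => /negP.
Qed.

(** Under such a map the potential pulled back to [Gtilde n] keeps its law, by [pull_ident]; the
    identity, the mirror and the translations by [offs n] qualify. *)
Definition admissible n (f : pt -> pt) :=
  uniq (map f (Gtilde n)) /\ forall x, x \in Gtilde n -> inG (f x).

(* The count on the image of the truncated triangle under [f]. *)
Definition count_at n f w : R := (ncount E (Gtilde n) (pull V f w))%:R.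

Lemma admissible_id n : admissible n id.
Proof. by split; rewrite ?map_id ?Gtilde_uniq // => x /Gtilde_Gn/Gn_inG. Qed.

Lemma admissible_mirror n : admissible n mirror.
Proof.
split; last by move=> x /Gtilde_Gn/mirror_inG.
by rewrite map_inj_uniq ?Gtilde_uniq //; apply: inv_inj mirrorK.
Qed.

Lemma admissible_offs n a : a \in offs n -> admissible n (ptadd a).
Proof.
move=> an; split; first by rewrite map_inj_uniq ?Gtilde_uniq //; exact: ptadd_inj.
by move=> x /Gtilde_Gn/(ptadd_Gn an)/Gn_inG.
Qed.

Lemma sup_cylinder n k :
  <<s cyl (R := R) (Gtilde n) >> [set v | (k < ncount E (Gtilde n) v)%N].
Proof.
rewrite (_ : [set v | _] = ~` [set v | (ncount E (Gtilde n) v <= k)%N]).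
  by apply: sigma_algebraC; apply: kcount_cylinder; exact: Gtilde_uniq.
by apply/seteqP; split=> w /=; rewrite ltnNge => /negP.
Qed.

Lemma count_at_measurable n f k : admissible n f ->
  measurable [set w | (k < ncount E (Gtilde n) (pull V f w))%N].
Proof. by move=> [uf fG]; exact: kcount_measurable. Qed.

Lemma count_at_bmeas n f : admissible n f -> bmeas (count_at n f).
Proof.
move=> af; apply: (@bmeas_nat _ _ _ _ (size (Gtilde n))) => [k|w].
  exact: count_at_measurable.
exact: ncount_size.
Qed.

Definition mean_count n := Ex (count_at n id).

Lemma Ex_count_at n f : admissible n f -> Ex (count_at n f) = mean_count n.
Proof.
move=> af; have [uf fG] := af; have ai := admissible_id n; have [ui iG] := ai.
rewrite /mean_count !(@Ex_nat _ _ _ _ _ (size (Gtilde n))); try by move=> w; exact: ncount_size.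
- apply: eq_bigr => k _.
  exact: (congr1 fine (proj2 (pull_ident iidV uf ui fG iG (@sup_cylinder n k)))).
- by move=> k; exact: count_at_measurable.
- by move=> k; exact: count_at_measurable.
Qed.

Lemma Ex_count_atM n f g : admissible n f -> admissible n g ->
  uniq (map f (Gtilde n) ++ map g (Gtilde n)) ->
  Ex (fun w => count_at n f w * count_at n g w) = mean_count n * mean_count n.
Proof.
move=> af ag ufg; have [uf fG] := af; have [ug gG] := ag.
rewrite -{1}(Ex_count_at af) -(Ex_count_at ag).
rewrite (@Ex_natM _ _ _ _ _ _ (size (Gtilde n))); try by move=> w; exact: ncount_size.
2,3: by move=> k; exact: count_at_measurable.
rewrite !(@Ex_nat _ _ _ _ _ (size (Gtilde n))); try by move=> w; exact: ncount_size.
2,3: by move=> k; exact: count_at_measurable.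
rewrite mulr_suml; apply: eq_bigr => k _; rewrite mulr_sumr; apply: eq_bigr => l _.
rewrite -fineM; first congr fine.
- exact: (pull_indep iidV ufg fG gG (@sup_cylinder n k) (@sup_cylinder n l)).
- by apply: fin_num_measure; exact: count_at_measurable.
- by apply: fin_num_measure; exact: count_at_measurable.
Qed.

Lemma Ex_count_at2 n f : admissible n f ->
  Ex (fun w => count_at n f w * count_at n f w) = Ex (fun w => count_at n id w * count_at n id w).
Proof.
move=> af; have [uf fG] := af; have ai := admissible_id n; have [ui iG] := ai.
rewrite !(@Ex_natM _ _ _ _ _ _ (size (Gtilde n))); try by move=> w; exact: ncount_size.
2,3,4,5: by move=> k; exact: count_at_measurable.
apply: eq_bigr => k _; apply: eq_bigr => l _.
have sI := @measurableI _ (g_sigma_algebraType (cyl (Gtilde n))) _ _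
  (@sup_cylinder n k) (@sup_cylinder n l).
exact: (congr1 fine (proj2 (pull_ident iidV uf ui fG iG sI))).
Qed.

Definition centered n f w : R := count_at n f w - mean_count n.

Lemma centered_bmeas n f : admissible n f -> bmeas (centered n f).
Proof. by move=> af; apply: bmeasB (count_at_bmeas af) (bmeas_cst _ _). Qed.

Lemma Ex_centered n f : admissible n f -> Ex (centered n f) = 0.
Proof.
move=> af; rewrite /centered (ExB _ (count_at_bmeas af) (bmeas_cst _ _)) Ex_count_at // Ex_cst.
by rewrite subrr.
Qed.

Lemma Ex_centeredM n f g : admissible n f -> admissible n g ->
  Ex (fun w => centered n f w * centered n g w) =
  Ex (fun w => count_at n f w * count_at n g w) - mean_count n * mean_count n.
Proof.
move=> af ag; have bf := count_at_bmeas af; have bg := count_at_bmeas ag.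
have bX := centered_bmeas ag.
transitivity (Ex (fun w => count_at n f w * count_at n g w
    - mean_count n * count_at n f w - mean_count n * centered n g w)).
  by apply: eq_Ex => w; rewrite /centered;
    move: (count_at _ _ _) (count_at _ _ _) (mean_count _) => x y z; ring.
rewrite (ExB _ (bmeasB (bmeasM bf bg) (bmeasM (bmeas_cst _ (mean_count n)) bf))
  (bmeasM (bmeas_cst _ (mean_count n)) bX)).
rewrite (ExB _ (bmeasM bf bg) (bmeasM (bmeas_cst _ (mean_count n)) bf)) !ExZ //.
by rewrite Ex_centered // Ex_count_at // mulr0 subr0.
Qed.

Definition var_count n := Ex (fun w => centered n id w * centered n id w).

Lemma Ex_centered2 n f : admissible n f ->
  Ex (fun w => centered n f w * centered n f w) = var_count n.
Proof.
move=> af; have ai := admissible_id n.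
by rewrite /var_count (Ex_centeredM af af) (Ex_centeredM ai ai) Ex_count_at2.
Qed.

Lemma count_at_rec n w :
  count_at n (ptadd (0, 0)) w + count_at n (ptadd (side n, 0)) w
    + count_at n (ptadd (0, side n)) w
    <= count_at n.+1 id w <=
  count_at n (ptadd (0, 0)) w + count_at n (ptadd (side n, 0)) w
    + count_at n (ptadd (0, side n)) w + 3.
Proof.
have /andP[h1 h2] := ncount_rec E n (pull V id w).
by rewrite /count_at -!natrD !ler_nat; apply/andP; split.
Qed.

Lemma mean_count_rec n : 3 * mean_count n <= mean_count n.+1 <= 3 * mean_count n + 3.
Proof.
have [q1 q2 q3] := offs_mem n.
have [a1 a2 a3] := And3 (admissible_offs q1) (admissible_offs q2) (admissible_offs q3).
have [b1 b2 b3] := And3 (count_at_bmeas a1) (count_at_bmeas a2) (count_at_bmeas a3).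
have bS := bmeasD (bmeasD b1 b2) b3.
have eS : Ex (fun w => count_at n (ptadd (0, 0)) w + count_at n (ptadd (side n, 0)) w
    + count_at n (ptadd (0, side n)) w) = 3 * mean_count n.
  by rewrite (ExD _ (bmeasD b1 b2) b3) (ExD _ b1 b2) !Ex_count_at //; ring.
have bF := count_at_bmeas (admissible_id n.+1).
rewrite -eS; apply/andP; split.
  by apply: le_Ex => // w; have /andP[] := count_at_rec n w.
rewrite -[X in _ + X](Ex_cst P 3) -(ExD _ bS (bmeas_cst _ 3)).
apply: le_Ex => //; first exact: (bmeasD bS (bmeas_cst _ 3)).
by move=> w; have /andP[] := count_at_rec n w.
Qed.

(** [f - m'] is [s + t], where [s] is the centered sum and [t] a difference of two numbers between 0
    and 3. Then [(s + t)^2 <= 2 s^2 + 2 t^2] with [t^2 <= 9]. *)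
Lemma sqr_perturb (p q r f m m' : R) :
  p + q + r <= f -> f <= p + q + r + 3 -> 3 * m <= m' -> m' <= 3 * m + 3 ->
  (f - m') * (f - m') <= 2 * ((p - m + (q - m) + (r - m)) * (p - m + (q - m) + (r - m))) + 18.
Proof.
move=> h1 h2 h3 h4.
have [s [t [-> -> t1 t2]]] : exists s t, [/\ f - m' = s + t,
    p - m + (q - m) + (r - m) = s, -3 <= t & t <= 3].
  by exists (p - m + (q - m) + (r - m)), (f - (p + q + r) - (m' - 3 * m)); split; lra.
have : t * t <= 9 by nra.
by have := sqr_ge0 (s - t); rewrite expr2; nra.
Qed.

(** The 6 is the 2 of [sqr_perturb] times three copies; their cross terms vanish because translates
    of [Gtilde n] use disjoint sites. *)
Lemma var_count_rec n : var_count n.+1 <= 6 * var_count n + 18.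
Proof.
have [q1 q2 q3] := offs_mem n; have [n1 n2 n3] := offs_neq n.
have [a1 a2 a3] := And3 (admissible_offs q1) (admissible_offs q2) (admissible_offs q3).
have [b1 b2 b3] := And3 (centered_bmeas a1) (centered_bmeas a2) (centered_bmeas a3).
have bS := bmeasD (bmeasD b1 b2) b3.
have dis a b : a \in offs n -> b \in offs n -> a != b ->
    Ex (fun w => centered n (ptadd a) w * centered n (ptadd b) w) = 0.
  move=> an bn ab; rewrite Ex_centeredM ?Ex_count_atM ?subrr //; try exact: admissible_offs.
  rewrite cat_uniq !map_inj_uniq ?Gtilde_uniq /=; try exact: ptadd_inj.
  rewrite andbT; apply/hasPn => x /mapP[y yt ->]; apply/negP => /mapP[y' yt' e].
  have ba : b != a by rewrite eq_sym.
  exact: (Gtilde_translates_disjoint bn an ba yt (Gtilde_Gn yt') e).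
have eS : Ex (fun w => (centered n (ptadd (0, 0)) w + centered n (ptadd (side n, 0)) w
    + centered n (ptadd (0, side n)) w) ^+ 2) = 3 * var_count n.
  exact: (Ex_sqr_sum3 b1 b2 b3 (Ex_centered2 a1) (Ex_centered2 a2) (Ex_centered2 a3)
    (dis _ _ q1 q2 n1) (dis _ _ q1 q3 n2) (dis _ _ q2 q3 n3)).
have bS2 := bmeasM bS bS.
have bX := centered_bmeas (admissible_id n.+1).
have -> : 6 * var_count n + 18 = Ex (fun w => 2 * ((centered n (ptadd (0, 0)) w +
    centered n (ptadd (side n, 0)) w + centered n (ptadd (0, side n)) w) *
    (centered n (ptadd (0, 0)) w + centered n (ptadd (side n, 0)) w
      + centered n (ptadd (0, side n)) w)) + 18).
  rewrite (ExD _ (bmeasM (bmeas_cst _ 2) bS2) (bmeas_cst _ 18)) (ExZ _ 2 bS2) Ex_cst.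
  under eq_Ex do rewrite -expr2.
  by rewrite eS; ring.
apply: le_Ex; first exact: (bmeasM bX bX).
  exact: (bmeasD (bmeasM (bmeas_cst _ 2) bS2) (bmeas_cst _ 18)).
move=> w; rewrite /centered; have /andP[h1 h2] := count_at_rec n w.
have /andP[h3 h4] := mean_count_rec n.
exact: sqr_perturb h1 h2 h3 h4.
Qed.

Lemma var_count_bound n : var_count n <= 4 * 6 ^+ n.
Proof.
(* Minus [18 / 5] is the fixed point of [x |-> 6 x + 18], so this offset makes the recursion
   geometric. It starts from 0 because [Gtilde 0] is empty. *)
suff : var_count n + 18 / 5 <= 18 / 5 * 6 ^+ n.
  have : 0 <= 6 ^+ n :> R by rewrite exprn_ge0.
  by move: (6 ^+ n) => x; lra.
elim: n => [|n IH].
  have F0 w : count_at 0 id w = 0.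
    apply/eqP; rewrite pnatr_eq0 -leqn0; apply: leq_trans (ncount_size _ _ _) _.
    by [].
  have mu0 : mean_count 0 = 0 by rewrite /mean_count -(Ex_cst P 0); apply: eq_Ex.
  rewrite expr0 mulr1 (_ : var_count 0 = 0) ?add0r // /var_count -(Ex_cst P 0).
  by apply: eq_Ex => w; rewrite /centered F0 mu0 subrr mul0r.
have := var_count_rec n; rewrite exprS; move: IH.
by move: (var_count n) (var_count n.+1) (6 ^+ n) => x y u; lra.
Qed.

Lemma exp3_size n : (3 ^ n.+1)%N%:R = 2 * (size (Gtilde n))%:R + 3 :> R.
Proof. by rewrite -size_Gtilde natrD natrM. Qed.

Lemma mean_count_cvg : exists m : R, (fun n => mean_count n / 3 ^+ n) @ \oo --> m.
Proof.
have p0 n : 0 < 3 ^+ n :> R by rewrite exprn_gt0.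
exists (sup (range (fun n => mean_count n / 3 ^+ n))); apply: nondecreasing_cvgn.
  apply/nondecreasing_seqP => n; have /andP[h _] := mean_count_rec n.
  rewrite ler_pdivrMr //.
  have -> : mean_count n.+1 / 3 ^+ n.+1 * 3 ^+ n = mean_count n.+1 / 3.
    by rewrite exprS invfM -mulrA mulfVK // gt_eqF.
  by rewrite ler_pdivlMr // mulrC.
(* The count is at most the number of sites, which is below [3 ^ n.+1 / 2]. *)
exists (3 / 2) => _ [n _ <-]; rewrite ler_pdivrMr //.
have -> : 3 / 2 * 3 ^+ n = (3 ^ n.+1)%N%:R / 2 :> R by rewrite natrX exprS; ring.
have : mean_count n <= (size (Gtilde n))%:R.
  rewrite -(Ex_cst P (size (Gtilde n))%:R); apply: le_Ex.
  - exact/count_at_bmeas/admissible_id.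
  - exact: bmeas_cst.
  - by move=> w; rewrite ler_nat ncount_size.
by rewrite exp3_size; lra.
Qed.

Lemma count_at_cvg (m : R) f : (forall n, admissible n f) ->
  (fun n => mean_count n / 3 ^+ n) @ \oo --> m ->
  {ae P, forall w, (fun n => count_at n f w / 3 ^+ n) @ \oo --> m}.
Proof.
move=> af cm.
have := @ae_cvg0 _ _ _ P (fun n => centered n f) (fun n => centered_bmeas (af n)).
have h n : Ex (fun w => centered n f w ^+ 2) <= 4 * 6 ^+ n.
  by under eq_Ex do rewrite expr2; rewrite Ex_centered2 // var_count_bound.
move=> /(_ h); apply: filterS => w cX.
rewrite (_ : (fun n => _) = (fun n => centered n f w / 3 ^+ n)
  \+ (fun n => mean_count n / 3 ^+ n)).
  by rewrite -[m]add0r; exact: cvgD.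
by apply/funext => n /=; rewrite -mulrDl subrK.
Qed.

Lemma eigcount_bmeas b (A : seq pt) : uniq A -> (forall x, x \in A -> inG x) ->
  bmeas (fun w => (eigcount E (Hmx b A (V ^~ w)))%:R : R).
Proof.
move=> uA AG; apply: (@bmeas_nat _ _ _ _ (size A)) => [k|w].
  have uI : uniq (map id A) by rewrite map_id.
  have mk := kcount_measurable (diag_term b A) k uI AG.
  have -> : [set w | (k < eigcount E (Hmx b A (V ^~ w)))%N] =
      [set w | (k < kcount (0%R, 0%R) E (hker (diag_term b A) (pull V id w)) A)%N].
    by apply/seteqP; split=> w /=; rewrite eigcount_Hmx.
  exact: mk.
by rewrite eigcount_Hmx //; exact/kcount_size/hker_sym.
Qed.

Lemma scaled_expectation_cvg (f : nat -> T -> R) (s : nat -> nat) (l : R) :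
  (forall n, bmeas (f n)) -> (fun n => Ex (f n) / (s n)%:R) @ \oo --> l ->
  (fun n => ('E_P[f n] * ((s n)%:R^-1)%:E)%E) @ \oo --> l%:E.
Proof.
move=> bf h; rewrite (_ : (fun n => _) = fun n => (Ex (f n) / (s n)%:R)%:E).
  by apply: cvg_EFin => //; near=> n.
by apply/funext => n; rewrite expectation_Ex // EFinM.
Unshelve. all: by end_near.
Qed.

Lemma dist_nat (a b k : nat) : (a <= b + k)%N -> (b <= a + k)%N ->
  `|a%:R - b%:R| <= k%:R :> R.
Proof.
rewrite -!(ler_nat R) !natrD => h1 h2; rewrite ler_norml; apply/andP; split; lra.
Qed.

Lemma dist_Ex (f g : T -> R) (k : R) : bmeas f -> bmeas g -> (forall w, `|f w - g w| <= k) ->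
  `|Ex f - Ex g| <= k.
Proof.
move=> bf bg h; have bk := bmeas_cst T k; rewrite -ExB // ler_norml.
rewrite -(Ex_cst P (- k)) -{2}(Ex_cst P k).
have bfg := bmeasB bf bg; have bNk := bmeas_cst T (- k).
by apply/andP; split; apply: le_Ex => // w; have := h w; rewrite ler_norml => /andP[].
Qed.

Lemma size_Gn_dist n : `|(size (Gn n))%:R - 3 / 2 * 3 ^+ n| <= 2 :> R.
Proof.
have -> : 3 / 2 * 3 ^+ n = (3 ^ n.+1)%N%:R / 2 :> R by rewrite natrX exprS; ring.
by rewrite size_Gn natrD exp3_size ler_norml; apply/andP; split; lra.
Qed.

Lemma size_BL_dist n : `|(size (BL n))%:R - 3 * 3 ^+ n| <= 3 :> R.
Proof.
have -> : 3 * 3 ^+ n = (3 ^ n.+1)%N%:R :> R by rewrite natrX exprS.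
have /andP[] := size_BL n; rewrite exp3_size -!(ler_nat R) natrD natrM ler_norml.
by move=> h1 h2; apply/andP; split; lra.
Qed.

End Main.

Theorem theorem4p2 (d : measure_display) (T : measurableType d) (R : realType)
  (P : probability T R) (V : pt -> T -> R) (E : R) :
  iid P inG V ->
  exists Nlim : R,
    (forall (bs : nat -> bc) (Ls : nat -> seq pt),
       (forall L, Ls L = Gn L \/ Ls L = Gtilde L) ->
       ((fun L => ('E_P[fun w => (eigcount E (Hmx (bs L) (Ls L) (V ^~ w)))%:R]
                   * ((size (Gn L))%:R^-1)%:E)%E) @ \oo --> Nlim%:E) /\
       {ae P, forall w, (fun L => (eigcount E (Hmx (bs L) (Ls L) (V ^~ w)))%:R
                                  / (size (Gn L))%:R) @ \oo --> Nlim}) /\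
    (forall b : bc,
       ((fun L => ('E_P[fun w => (eigcount E (Hmx b (BL L) (V ^~ w)))%:R]
                   * ((size (BL L))%:R^-1)%:E)%E) @ \oo --> Nlim%:E) /\
       {ae P, forall w, (fun L => (eigcount E (Hmx b (BL L) (V ^~ w)))%:R
                                  / (size (BL L))%:R) @ \oo --> Nlim}).
Proof.
move=> iidV.
have [m cm] := mean_count_cvg E iidV.
have c1 : 3 / 2 != 0 :> R by rewrite mulf_neq0 ?invr_eq0.
have c2 : 3 != 0 :> R by [].
(* The exceptional null set is fixed here, from the truncated triangles alone, and serves every
   later choice of [bs] and [Ls]. *)
have cF := count_at_cvg iidV admissible_id cm.
(* [m] is the limit per [3 ^ L], and [size (Gn L)] is [3 / 2 * 3 ^ L] up to a bounded error. *)
exists (m / (3 / 2)); split.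
  move=> bs Ls hLs.
  have uL L : uniq (Ls L) by case: (hLs L) => ->; [exact: Gn_uniq|exact: Gtilde_uniq].
  have GL L x : x \in Ls L -> inG x.
    by case: (hLs L) => ->; [|move/Gtilde_Gn]; exact: Gn_inG.
  have near L w : `|(eigcount E (Hmx (bs L) (Ls L) (V ^~ w)))%:R - count_at V E L id w| <= 6 :> R.
    by have [h1 h2] := ncount_T E (bs L) (V ^~ w) (hLs L); apply: dist_nat.
  have bL L := eigcount_bmeas E iidV (bs L) (uL L) (GL L).
  split.
    apply: scaled_expectation_cvg => //; apply: ratio_cvg c1 _ (@size_Gn_dist R) cm => L.
    exact: dist_Ex (bL L) (count_at_bmeas E iidV (admissible_id L)) (near L).
  apply: filterS cF => w; apply: ratio_cvg c1 _ (@size_Gn_dist R) => L; exact: near.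
move=> b.
have BG L x : x \in BL L -> inG x.
  by rewrite mem_BL => /orP[/Gn_inG //|/mirror_inG]; rewrite mirrorK.
have near L w : `|(eigcount E (Hmx b (BL L) (V ^~ w)))%:R
    - (count_at V E L id w + count_at V E L mirror w)| <= 12 :> R.
  have [h1 h2] := ncount_BL E L b (V ^~ w).
  by rewrite /count_at -natrD; apply: dist_nat.
have bL L := eigcount_bmeas E iidV b (BL_uniq L) (@BG L).
(* Each half contributes [m] while [size (BL L)] grows like [3 * 3 ^ L], so both normalisations give
   the same limit. *)
have -> : m / (3 / 2) = (m + m) / 3 by field.
have bI L := count_at_bmeas E iidV (admissible_id L).
have bM L := count_at_bmeas E iidV (admissible_mirror L).
split.
  apply: scaled_expectation_cvg => //.
  apply: (@ratio_cvg _ _ (fun L => mean_count P V E L + mean_count P V E L)) c2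
    _ (@size_BL_dist R) _.
    (* One of the two equal means is read as the mean over the mirrored half, to match the pointwise
       bound [near]. *)
    move=> L; rewrite -{2}(Ex_count_at E iidV (admissible_mirror L)) -ExD //.
    exact: dist_Ex (bL L) (bmeasD (bI L) (bM L)) (near L).
  have -> : (fun L => (mean_count P V E L + mean_count P V E L) / 3 ^+ L) =
      (fun L => mean_count P V E L / 3 ^+ L) \+ (fun L => mean_count P V E L / 3 ^+ L).
    by apply/funext => L; rewrite mulrDl.
  exact: cvgD.
have cM := count_at_cvg iidV admissible_mirror cm.
apply: filterS2 cF cM => w h1 h2.
apply: ratio_cvg c2 (near ^~ w) (@size_BL_dist R) _.
have -> : (fun L => (count_at V E L id w + count_at V E L mirror w) / 3 ^+ L) =
    (fun L => count_at V E L id w / 3 ^+ L) \+ (fun L => count_at V E L mirror w / 3 ^+ L).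
  by apply/funext => L; rewrite mulrDl.
exact: cvgD.
Qed.
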